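(* Let $G \subset \mathrm{Diff}^1_+(\mathbb{S}^2)$ be a group with $\mathrm{M\ddot{o}b}(\mathbb{S}^2) \subsetneq G$. Then the identity component $G_0$ of $G$ is arc $4$-transitive: for every pair of $4$-tuples $(p_1,\dots,p_4)$ and $(q_1,\dots,q_4)$, each consisting of mutually distinct points of $\mathbb{S}^2$, there exists a family $(g_t)_{t\in[0,1]}$ with $g_t \in G$ for all $t$, $g_0=\mathrm{id}$, $t\mapsto g_t$ continuous for the uniform metric $d_\infty(f,g)=\max_{p}d(f(p),g(p))$, and $g_1(p_i)=q_i$ for $i=1,\dots,4$. In particular, $G$ is $4$-transitive.
   Context: $\mathrm{Diff}^1_+(\mathbb{S}^2)$ denotes the group of orientation-preserving $C^1$ diffeomorphisms of the unit sphere $\mathbb{S}^2$. The sphere is identified with $\mathbb{C}\cup\{\infty\}$ by stereographic projection from the North Pole; $\mathrm{M\ddot{o}b}(\mathbb{S}^2)$ is the group of maps $z\mapsto (az+b)/(cz+d)$ with $a,b,c,d\in\mathbb{C}$, $ad-bc=1$ (the conformal orientation-preserving diffeomorphisms of $\mathbb{S}^2$). The identity component $G_0$ is the path component of the identity of $G$ with respect to the uniform topology. A group is $k$-transitive if any $k$-tuple of mutually distinct points can be mapped onto any other such $k$-tuple by a single element of the group. *)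

(* Defs.v *)
From HB Require Import structures.
From mathcomp Require Import all_boot all_order all_algebra.
From mathcomp Require Import complex.
From mathcomp Require Import all_classical all_reals all_analysis.
Set Implicit Arguments. Unset Strict Implicit. Unset Printing Implicit Defensive.
Import Order.TTheory GRing.Theory Num.Theory.
Import numFieldNormedType.Exports.
Local Open Scope classical_set_scope.
Local Open Scope ring_scope.

Section Sphere.
Variable R : realType.

Definition vec := 'rV[R]_3.
Definition mkv (x y z : R) : vec := \row_(j < 3) nth 0 [:: x; y; z] j.
Definition cx (p : vec) : R := p ord0 (inord 0).
Definition cy (p : vec) : R := p ord0 (inord 1).
Definition cz (p : vec) : R := p ord0 (inord 2).

Definition dotv (u v : vec) : R := \sum_(i < 3) u ord0 i * v ord0 i.
Definition edist (u v : vec) : R := Num.sqrt (dotv (u - v) (u - v)).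
Definition cross (u v : vec) : vec :=
  mkv (cy u * cz v - cz u * cy v) (cz u * cx v - cx u * cz v)
      (cx u * cy v - cy u * cx v).
Definition det3 (u v w : vec) : R := dotv u (cross v w).

Definition sph := {p : vec | dotv p p == 1}.

Definition C1_on (U : set vec) (F : vec -> vec) :=
  forall x, U x -> forall v : vec,
    derivable F x v /\ {for x, continuous (fun y => 'D_v F y)}.

Definition C1_ext (f : sph -> sph) (U : set vec) (F : vec -> vec) :=
  [/\ open U, (forall p : sph, U (val p)),
      (forall p : sph, F (val p) = val (f p)) & C1_on U F].

Definition C1_sph (f : sph -> sph) := exists U F, C1_ext f U F.

(* orientation preserving (S^2 oriented by the outward normal):
   df_p maps positively oriented tangent bases at p to positively
   oriented tangent bases at f p *)
Definition orient_pres (f : sph -> sph) :=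
  exists U F, C1_ext f U F /\
    forall (p : sph) (u v : vec),
      dotv u (val p) = 0 -> dotv v (val p) = 0 -> 0 < det3 (val p) u v ->
      0 < det3 (val (f p)) ('D_u F (val p)) ('D_v F (val p)).

Definition Diff1plus (f : sph -> sph) :=
  [/\ C1_sph f, orient_pres f &
      exists g : sph -> sph, [/\ cancel f g, cancel g f & C1_sph g]].

Definition North : vec := mkv 0 0 1.
Definition stereo (p : vec) : R[i] :=
  (Complex (cx p) (cy p)) / (Complex (1 - cz p) 0).
Definition stereo_inv (w : R[i]) : vec :=
  let: Complex x y := w in
  let n := x ^+ 2 + y ^+ 2 in
  mkv (2 * x / (n + 1)) (2 * y / (n + 1)) ((n - 1) / (n + 1)).

Definition mob_vec (a b c d : R[i]) (p : vec) : vec :=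
  if p == North then (if c == 0 then North else stereo_inv (a / c))
  else let w := stereo p in
       if c * w + d == 0 then North else stereo_inv ((a * w + b) / (c * w + d)).

Definition Mob (f : sph -> sph) :=
  exists a b c d : R[i], a * d - b * c = 1 /\
    forall p : sph, val (f p) = mob_vec a b c d (val p).

Definition subgroup_Diff (G : set (sph -> sph)) :=
  [/\ G `<=` Diff1plus, G id,
      (forall f g, G f -> G g -> G (f \o g)) &
      (forall f, G f -> exists g, [/\ G g, cancel f g & cancel g f])].

Definition unif_cont01 (g : R -> sph -> sph) :=
  forall t, 0 <= t <= 1 -> forall eps : R, 0 < eps ->
    exists2 delta : R, 0 < delta & forall s, 0 <= s <= 1 -> `|s - t| < delta ->
      forall p : sph, edist (val (g s p)) (val (g t p)) < eps.

End Sphere.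

(* Main.v *)
(** Reduction to the plane: the Moebius group is 3-transitive, so 4-transitivity
    of a group H of diffeomorphisms containing it says that the stabiliser of
    0, 1, oo acts transitively on cross ratios z in C \ {0, 1}.  This set is
    connected and the stabiliser acts by homeomorphisms, so it is enough that
    every orbit has an interior point, and by the inverse function theorem that
    some map, with values in the orbit of z and defined on an open subset of the
    plane, has an invertible derivative somewhere.

    Let f in H be non-Moebius with f(oo) = oo.  If f is conformal everywhere,
    the ratio (f(a+zh)-f(a)) / (f(a+h)-f(a)) is holomorphic along dilates of h
    and tends to z at h = 0; were its derivative always 0, f would satisfy
    f(a+zh)-f(a) = z(f(a+h)-f(a)), hence be affine.  Otherwise we may assume that
    f(0) = 0 and that f has derivative w |-> w + m conj w at 0, with 0 < m < 1.
    For non-real z, apply f near 0, rotate and apply f again: the two rotation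
    angles move the cross ratio in independent directions.  For real z, f maps
    some small circle through 0 to a curve which is not a circle, and takes a
    quadruple of cross ratio z on it to one with non-real cross ratio.

    To produce arcs, apply this to the arc component G_0 of the identity in G,
    a normal subgroup.  It contains the Moebius group, which is generated by
    translations and their conjugates under z |-> -1/z; it is larger, for
    otherwise a normalised f in G would normalise the translations and the
    dilations, and be a continuous automorphism of the field C preserving
    orientation. *)

Require Import Defs.
From HB Require Import structures.
From mathcomp Require Import all_boot all_order all_algebra.
From mathcomp Require Import complex.
From mathcomp Require Import all_classical all_reals all_analysis.
From mathcomp Require Import ring lra.
Set Implicit Arguments. Unset Strict Implicit. Unset Printing Implicit Defensive.
Import Order.TTheory GRing.Theory Num.Theory.
Import numFieldNormedType.Exports.
Local Open Scope classical_set_scope.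
Local Open Scope ring_scope.

(** * Strict differentiability in the plane *)

Section Modulus.
Variable R : realType.
Local Notation C := R[i].
Implicit Types (x y z w a b h : C).

(** The norm on [R[i]] takes values in [R[i]]; a modulus with values in [R] can be compared directly
    with real epsilons. *)
Definition cmod (x : C) : R := Num.sqrt (complex.Re x ^+ 2 + complex.Im x ^+ 2).

Lemma cmodE x : cmod x = ComplexField.Normc.normc x.
Proof. by case: x. Qed.

Lemma cmod_ge0 x : 0 <= cmod x. Proof. exact: sqrtr_ge0. Qed.

Lemma cmod0 : cmod 0 = 0. Proof. by rewrite cmodE ComplexField.Normc.normc0. Qed.
Lemma cmod1 : cmod 1 = 1. Proof. by rewrite cmodE ComplexField.Normc.normc1. Qed.

Lemma cmod_eq0 x : (cmod x == 0) = (x == 0).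
Proof.
apply/eqP/eqP => [|->]; last exact: cmod0.
by rewrite cmodE => /ComplexField.Normc.eq0_normc.
Qed.

Lemma cmod_gt0 x : (0 < cmod x) = (x != 0).
Proof. by rewrite lt0r cmod_eq0 cmod_ge0 andbT. Qed.

Lemma cmodM x y : cmod (x * y) = cmod x * cmod y.
Proof. by rewrite !cmodE ComplexField.Normc.normcM. Qed.

Lemma cmodV x : cmod x^-1 = (cmod x)^-1.
Proof. by rewrite !cmodE ComplexField.Normc.normcV. Qed.

Lemma cmodD x y : cmod (x + y) <= cmod x + cmod y.
Proof. by rewrite !cmodE; exact: le_normcD. Qed.

Lemma cmodN x : cmod (- x) = cmod x.
Proof. by rewrite /cmod; case: x => u v /=; rewrite !sqrrN. Qed.

Lemma cmodJ x : cmod (conjc x) = cmod x.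
Proof. by rewrite /cmod; case: x => u v /=; rewrite !sqrrN. Qed.

Lemma cmodB x y : cmod (x - y) <= cmod x + cmod y.
Proof. by rewrite -(cmodN y) cmodD. Qed.

Lemma cmod_distC x y : cmod (x - y) = cmod (y - x).
Proof. by rewrite -cmodN opprB. Qed.

Lemma cmod_distD z x y : cmod (x - y) <= cmod (x - z) + cmod (z - y).
Proof. by rewrite (_ : x - y = (x - z) + (z - y)) ?cmodD //; ring. Qed.

Lemma cmodR (r : R) : cmod r%:C%C = `|r|.
Proof. by rewrite /cmod /= expr0n addr0 sqrtr_sqr. Qed.

Lemma cmod_Re x : `|complex.Re x| <= cmod x.
Proof. by rewrite -sqrtr_sqr ler_wsqrtr // lerDl sqr_ge0. Qed.

Lemma cmod_Im x : `|complex.Im x| <= cmod x.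
Proof. by rewrite -sqrtr_sqr ler_wsqrtr // lerDr sqr_ge0. Qed.

Lemma cmod_ReIm x : cmod x <= `|complex.Re x| + `|complex.Im x|.
Proof.
rewrite -ler_sqr ?nnegrE ?sqrtr_ge0 ?addr_ge0 // sqr_sqrtr ?addr_ge0 ?sqr_ge0 //.
by rewrite sqrrD !real_normK ?num_real // lerD2r lerDl mulrn_wge0 // mulr_ge0.
Qed.

Lemma cmod_le0 x : (forall e : R, 0 < e -> cmod x <= e) -> x = 0.
Proof.
move=> h; apply/eqP; rewrite -cmod_eq0 eq_le cmod_ge0 andbT.
by apply/ler_addgt0Pr => e /h; rewrite add0r.
Qed.

(** Turns statements about moduli into polynomial identities in [x] and its conjugate, within reach
    of [ring] and [field]. *)
Lemma cmod_sqrE x : (cmod x ^+ 2)%:C%C = x * conjc x.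
Proof.
rewrite sqr_sqrtr ?addr_ge0 ?sqr_ge0 //; case: x => u v /=; simpc => /=.
by apply/eqP; rewrite eq_complex /=; apply/andP; split; apply/eqP; ring.
Qed.

Lemma conjcZ (r : R) x : conjc (r%:C%C * x) = r%:C%C * conjc x.
Proof. by case: x => u v; simpc; congr Complex; ring. Qed.

Lemma conjcD x y : conjc (x + y) = conjc x + conjc y. Proof. exact: rmorphD. Qed.
Lemma conjcB x y : conjc (x - y) = conjc x - conjc y. Proof. exact: rmorphB. Qed.
Lemma conjcN x : conjc (- x) = - conjc x. Proof. exact: rmorphN. Qed.
Lemma conjcM x y : conjc (x * y) = conjc x * conjc y. Proof. exact: rmorphM. Qed.
Lemma conjcX x n : conjc (x ^+ n) = conjc x ^+ n. Proof. exact: rmorphXn. Qed.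

Lemma ltr_cmod x y : (cmod x < cmod y) = (cmod x ^+ 2 < cmod y ^+ 2).
Proof. by rewrite ltr_sqr // nnegrE cmod_ge0. Qed.

End Modulus.

Ltac conj_push := rewrite ?(conjcD, conjcB, conjcN, conjcM, conjcX,
  conjc_inv, conjcK, conjc0, conjc1, conjc_nat, conjc_real).


(** * Calculus of strict real derivatives of maps of the plane *)

Section StrictDerivative.
Variable R : realType.
Local Notation C := R[i].
Implicit Types (x y z w a b h : C) (f g : C -> C).

(* A real-linear map of the plane: conformal iff [b = 0], invertible and
   orientation preserving iff [|b| < |a|]. *)
Definition rlin a b h : C := a * h + b * conjc h.

Lemma rlin_le a b h : cmod (rlin a b h) <= (cmod a + cmod b) * cmod h.
Proof. by apply: le_trans (cmodD _ _) _; rewrite !cmodM cmodJ mulrDl. Qed.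

Lemma rlinB a b x y : rlin a b (x - y) = rlin a b x - rlin a b y.
Proof. by rewrite /rlin rmorphB /=; ring. Qed.

Lemma rlinZ a b (r : R) h : rlin a b (r%:C%C * h) = r%:C%C * rlin a b h.
Proof. by rewrite /rlin conjcZ; ring. Qed.

(** Strict differentiability: both points move. At a single point it already gives a Lipschitz bound
    and the inverse function theorem; holding everywhere, it gives continuity of the derivative. *)
Definition sdiff f w a b := forall e : R, 0 < e -> exists2 d : R, 0 < d &
  forall x y, cmod (x - w) < d -> cmod (y - w) < d ->
    cmod (f x - f y - rlin a b (x - y)) <= e * cmod (x - y).

Lemma sdiff_weak f w a b (K : R) : 0 < K ->
  (forall e : R, 0 < e -> e <= 1 -> exists2 d : R, 0 < d &
    forall x y, cmod (x - w) < d -> cmod (y - w) < d ->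
    cmod (f x - f y - rlin a b (x - y)) <= K * e * cmod (x - y)) ->
  sdiff f w a b.
Proof.
move=> K0 H e e0.
pose e' := Num.min 1 (e / K).
have e'0 : 0 < e' by rewrite lt_min ltr01 divr_gt0.
have e'1 : e' <= 1 by rewrite ge_min lexx.
have [d d0 Hd] := H e' e'0 e'1.
exists d => // x y hx hy; apply: le_trans (Hd _ _ hx hy) _.
rewrite ler_wpM2r ?cmod_ge0 // mulrC -ler_pdivlMr //.
by rewrite ge_min lexx orbT.
Qed.

Lemma sdiff_lip f w a b : sdiff f w a b -> exists2 d : R, 0 < d &
  forall x y, cmod (x - w) < d -> cmod (y - w) < d ->
    cmod (f x - f y) <= (cmod a + cmod b + 1) * cmod (x - y).
Proof.
move=> /(_ 1 ltr01)[d d0 H]; exists d => // x y hx hy.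
rewrite (_ : f x - f y = (f x - f y - rlin a b (x - y)) + rlin a b (x - y)); last by ring.
apply: le_trans (cmodD _ _) _; rewrite mulrDl addrC lerD ?rlin_le ?H //.
Qed.

Lemma sdiff_cont f w a b : sdiff f w a b -> forall e : R, 0 < e ->
  exists2 d : R, 0 < d & forall x, cmod (x - w) < d -> cmod (f x - f w) < e.
Proof.
move=> /sdiff_lip[d d0 H] e e0.
have K0 : 0 < cmod a + cmod b + 1.
  by rewrite ltr_wpDl ?addr_ge0 ?cmod_ge0.
exists (Num.min d (e / (cmod a + cmod b + 1))).
  by rewrite lt_min d0 divr_gt0.
move=> x; rewrite lt_min => /andP[xd xe].
apply: le_lt_trans (H _ _ xd _) _; first by rewrite subrr cmod0.
by rewrite mulrC -ltr_pdivlMr.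
Qed.

Lemma sdiff_const c w : sdiff (fun=> c) w 0 0.
Proof.
move=> e e0; exists 1 => // x y _ _.
by rewrite /rlin subrr !mul0r addr0 subrr cmod0 mulr_ge0 ?cmod_ge0 ?ltW.
Qed.

Lemma sdiff_id w : sdiff id w 1 0.
Proof.
move=> e e0; exists 1 => // x y _ _.
by rewrite /rlin mul1r mul0r addr0 subrr cmod0 mulr_ge0 ?cmod_ge0 ?ltW.
Qed.

Lemma sdiff_conj w : sdiff conjc w 0 1.
Proof.
move=> e e0; exists 1 => // x y _ _.
rewrite /rlin mul1r mul0r add0r rmorphB /= subrr cmod0.
by rewrite mulr_ge0 ?cmod_ge0 ?ltW.
Qed.

Lemma sdiff_ext f g w a b : f =1 g -> sdiff f w a b -> sdiff g w a b.
Proof. by move=> /funext ->. Qed.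

Lemma sdiff_eq f w a b a' b' : sdiff f w a b -> a = a' -> b = b' ->
  sdiff f w a' b'.
Proof. by move=> h <- <-. Qed.

Lemma sdiffD f g w a b a' b' : sdiff f w a b -> sdiff g w a' b' ->
  sdiff (fun x => f x + g x) w (a + a') (b + b').
Proof.
move=> hf hg; apply: (@sdiff_weak _ _ _ _ 2) => // e e0 _.
have [d d0 H] := hf e e0; have [d' d'0 H'] := hg e e0.
exists (Num.min d d'); first by rewrite lt_min d0.
move=> x y; rewrite !lt_min => /andP[? ?] /andP[? ?].
rewrite (_ : _ - _ = (f x - f y - rlin a b (x - y)) + (g x - g y - rlin a' b' (x - y))); last first.
  by rewrite /rlin; ring.
apply: le_trans (cmodD _ _) _.
by rewrite -mulrA mulr_natl mulr2n lerD ?H ?H'.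
Qed.

Lemma sdiffM f g w a b a' b' : sdiff f w a b -> sdiff g w a' b' ->
  sdiff (fun x => f x * g x) w (a * g w + f w * a') (b * g w + f w * b').
Proof.
move=> hf hg.
pose K := (cmod (g w) + 1) + (cmod a + cmod b) + (cmod (f w) + 1) + (cmod a' + cmod b').
have K0 : 0 < K.
  have := cmod_ge0 a; have := cmod_ge0 b; have := cmod_ge0 a'; have := cmod_ge0 b'.
  have := cmod_ge0 (f w); have := cmod_ge0 (g w); rewrite /K; lra.
apply: (@sdiff_weak _ _ _ _ K) => // e e0 e1.
have [d1 d10 H1] := hf e e0; have [d2 d20 H2] := hg e e0.
have [d3 d30 H3] := sdiff_cont hf e0; have [d4 d40 H4] := sdiff_cont hg e0.
exists (Num.min (Num.min d1 d2) (Num.min d3 d4)).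
  by rewrite !lt_min d10 d20 d30.
move=> x y; rewrite !lt_min => /andP[/andP[x1 x2] /andP[x3 x4]].
move=> /andP[/andP[y1 y2] /andP[y3 y4]].
(* The four error terms correspond, in this order, to the four summands of [K]. *)
rewrite (_ : _ - _ = (f x - f y - rlin a b (x - y)) * g x + rlin a b (x - y) * (g x - g w)
   + f y * (g x - g y - rlin a' b' (x - y)) + (f y - f w) * rlin a' b' (x - y)); last first.
  by rewrite /rlin; ring.
have gx : cmod (g x) <= cmod (g w) + 1.
  rewrite (_ : g x = g w + (g x - g w)); last by ring.
  by apply: le_trans (cmodD _ _) _; rewrite lerD2l (le_trans (ltW (H4 _ x4))).
have fy : cmod (f y) <= cmod (f w) + 1.
  rewrite (_ : f y = f w + (f y - f w)); last by ring.
  by apply: le_trans (cmodD _ _) _; rewrite lerD2l (le_trans (ltW (H3 _ y3))).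
have n0 := cmod_ge0 (x - y).
have -> : K * e * cmod (x - y) = e * cmod (x - y) * (cmod (g w) + 1)
  + (cmod a + cmod b) * cmod (x - y) * e + (cmod (f w) + 1) * (e * cmod (x - y))
  + e * ((cmod a' + cmod b') * cmod (x - y)) by rewrite /K; ring.
apply: le_trans (cmodD _ _) _; apply: lerD.
  apply: le_trans (cmodD _ _) _; apply: lerD.
    apply: le_trans (cmodD _ _) _; rewrite !cmodM; apply: lerD.
      by apply: ler_pM; rewrite ?cmod_ge0 ?H1.
    by apply: ler_pM; rewrite ?cmod_ge0 ?rlin_le // ltW ?H4.
  by rewrite cmodM; apply: ler_pM; rewrite ?cmod_ge0 ?H2.
by rewrite cmodM; apply: ler_pM; rewrite ?cmod_ge0 ?rlin_le // ltW ?H3.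
Qed.

Lemma sdiff_comp f g w a b a' b' : sdiff f (g w) a b -> sdiff g w a' b' ->
  sdiff (f \o g) w (a * a' + b * conjc b') (a * b' + b * conjc a').
Proof.
move=> hf hg.
pose K := (cmod a' + cmod b' + 1) + (cmod a + cmod b).
have K0 : 0 < K.
  have := cmod_ge0 a; have := cmod_ge0 b; have := cmod_ge0 a'; have := cmod_ge0 b'.
  rewrite /K; lra.
apply: (@sdiff_weak _ _ _ _ K) => // e e0 e1.
have [d1 d10 H1] := hf e e0; have [d2 d20 H2] := hg e e0.
have [d3 d30 H3] := sdiff_cont hg d10; have [d4 d40 H4] := sdiff_lip hg.
exists (Num.min d2 (Num.min d3 d4)).
  by rewrite !lt_min d20 d30.
move=> x y; rewrite !lt_min => /andP[x2 /andP[x3 x4]].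
move=> /andP[y2 /andP[y3 y4]] /=.
rewrite (_ : _ - _ = (f (g x) - f (g y) - rlin a b (g x - g y))
   + rlin a b (g x - g y - rlin a' b' (x - y))); last first.
  by rewrite /rlin; conj_push; ring.
apply: le_trans (cmodD _ _) _.
rewrite /K mulrDl mulrDl lerD //.
  apply: le_trans (H1 _ _ (H3 _ x3) (H3 _ y3)) _.
  by rewrite -mulrA mulrCA ler_wpM2l ?(ltW e0) // H4.
apply: le_trans (rlin_le _ _ _) _; rewrite -mulrA ler_wpM2l ?addr_ge0 ?cmod_ge0 //.
exact: H2.
Qed.

Lemma cmod_lt2 x w : cmod (x - w) < cmod w / 2 -> cmod w / 2 < cmod x.
Proof.
move=> h; have := cmodD (w - x) x; rewrite subrK cmod_distC; lra.
Qed.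

Lemma sdiffV w : w != 0 -> sdiff (fun x => x^-1) w (- (w ^+ 2)^-1) 0.
Proof.
move=> w0; have W : 0 < cmod w by rewrite cmod_gt0.
(* Near [w] both [|x|] and [|y|] exceed [|w|/2] and [|y| <= 2|w|]. The numerator below is then at
   most [3 e |w|] and the denominator at least [|w|^4 / 4], whence the constant 12. *)
have W3 : 0 < cmod w ^+ 3 by rewrite exprn_gt0.
apply: (@sdiff_weak _ _ _ _ (12 / cmod w ^+ 3)) => [|e e0 e1].
  by rewrite divr_gt0.
exists (Num.min (cmod w / 2) e); first by rewrite lt_min divr_gt0.
move=> x y; rewrite !lt_min => /andP[x1 x2] /andP[y1 y2].
have X := cmod_lt2 x1; have Y := cmod_lt2 y1.
have x0 : x != 0 by rewrite -cmod_gt0; lra.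
have y0 : y != 0 by rewrite -cmod_gt0; lra.
have Y2 : cmod y <= 2 * cmod w.
  by have := cmodD (y - w) w; rewrite subrK; lra.
rewrite (_ : _ - _ = (x - y) * (((x - w) * y + w * (y - w)) / (w ^+ 2 * (x * y)))); last first.
  by rewrite /rlin; field; rewrite w0 x0 y0.
rewrite cmodM mulrC ler_wpM2r ?cmod_ge0 // cmodM cmodV !cmodM.
have XY : cmod w ^+ 2 / 4 <= cmod x * cmod y.
  rewrite (_ : _ / 4 = (cmod w / 2) * (cmod w / 2)); last by field.
  by apply: ler_pM; rewrite ?divr_ge0 ?cmod_ge0 // ltW.
rewrite ler_pdivrMr; last by rewrite !mulr_gt0 // cmod_gt0.
have -> : 12 / cmod w ^+ 3 * e * (cmod w * cmod w * (cmod x * cmod y)) =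
  12 * e / cmod w * (cmod x * cmod y) by field; rewrite gt_eqF.
apply: le_trans (_ : 12 * e / cmod w * (cmod w ^+ 2 / 4) <= _); last first.
  by rewrite ler_wpM2l // divr_ge0 ?cmod_ge0 // mulr_ge0 // ltW.
have -> : 12 * e / cmod w * (cmod w ^+ 2 / 4) = e * (2 * cmod w) + cmod w * e.
  by field; rewrite gt_eqF.
apply: le_trans (cmodD _ _) _; rewrite !cmodM; apply: lerD.
  by apply: ler_pM; rewrite ?cmod_ge0 // ltW.
by rewrite ler_wpM2l ?cmod_ge0 // ltW.
Qed.

Lemma rlin_inj (a b a' b' : C) : (forall h, rlin a b h = rlin a' b' h) -> a = a' /\ b = b'.
Proof.
move=> H; have := H 1; have := H 'i%C; rewrite /rlin rmorph1 !mulr1.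
have -> : conjc 'i%C = - 'i%C :> C by simpc.
rewrite !mulrN -!mulrBl => /mulIf H1 H2.
have {}H1 : a - b = a' - b' by apply: H1; rewrite eq_complex /= oner_eq0 andbF.
have two : 2 != 0 :> C by rewrite pnatr_eq0.
split; apply: (mulIf two).
  transitivity ((a + b) + (a - b)); first by ring.
  by rewrite H1 H2; ring.
transitivity ((a + b) - (a - b)); first by ring.
by rewrite H1 H2; ring.
Qed.

(** The values at 1 and i bound [a + b] and [a - b], hence [2a] and [2b]. *)
Lemma rlin_small (a b : C) (e : R) : (forall h, cmod (rlin a b h) <= e * cmod h) ->
  cmod a <= e /\ cmod b <= e.
Proof.
move=> H.
have I0 : 'i%C != 0 :> C by rewrite eq_complex /= oner_eq0 andbF.
have I1 : cmod ('i%C : C) = 1 by rewrite /cmod /= expr0n expr1n add0r sqrtr1.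
have H1 := H 1; have H2 := H 'i%C.
have S1 : cmod (a + b) <= e.
  by move: H1; rewrite /rlin rmorph1 !mulr1 cmod1 mulr1.
have S2 : cmod (a - b) <= e.
  move: H2; rewrite /rlin (_ : conjc 'i%C = - 'i%C :> C); last by simpc.
  by rewrite mulrN -mulrBl cmodM I1 !mulr1.
have T2 : cmod (2 : C) = 2 by rewrite -[2 : C](rmorph_nat (real_complex R)) cmodR ger0_norm.
split.
  have := cmodD (a + b) (a - b).
  rewrite (_ : a + b + (a - b) = 2 * a); last by ring.
  by rewrite cmodM T2; lra.
have := cmodB (a + b) (a - b).
rewrite (_ : a + b - (a - b) = 2 * b); last by ring.
by rewrite cmodM T2; lra.
Qed.

Lemma small_scale h (d : R) : 0 < d -> exists2 r : R, 0 < r & cmod (r%:C%C * h) < d.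
Proof.
move=> d0; exists (d / (cmod h + 1)); first by rewrite divr_gt0 // ltr_wpDl ?cmod_ge0.
have K0 : 0 < cmod h + 1 by rewrite ltr_wpDl ?cmod_ge0.
rewrite cmodM cmodR ger0_norm ?divr_ge0 ?ltW //.
by rewrite mulrAC ltr_pdivrMr // ltr_pM2l // ltrDl.
Qed.

Lemma sdiff_deriv f w a b h (e : R) : sdiff f w a b -> 0 < e ->
  exists2 d : R, 0 < d & forall r : R, 0 < r -> r < d ->
    cmod ((f (w + r%:C%C * h) - f w) / r%:C%C - rlin a b h) <= e.
Proof.
move=> H e0; have K0 : 0 < cmod h + 1 by rewrite ltr_wpDl ?cmod_ge0.
have [d d0 Hd] := H _ (divr_gt0 e0 K0).
exists (d / (cmod h + 1)); first by rewrite divr_gt0.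
move=> r r0; rewrite ltr_pdivlMr // => rd.
have rC : r%:C%C != 0 :> C by rewrite -cmod_gt0 cmodR gtr0_norm.
have X : cmod (w + r%:C%C * h - w) < d.
  rewrite addrAC subrr add0r cmodM cmodR gtr0_norm //; apply: le_lt_trans rd.
  by rewrite ler_wpM2l ?(ltW r0) // lerDl.
have Y : cmod (w - w) < d by rewrite subrr cmod0.
have := Hd _ _ X Y; rewrite [w + _ - w]addrAC subrr add0r.
rewrite rlinZ => Z.
rewrite (_ : _ - _ = (f (w + r%:C%C * h) - f w - r%:C%C * rlin a b h) / r%:C%C); last first.
  by field.
rewrite cmodM cmodV cmodR gtr0_norm // ler_pdivrMr //; apply: le_trans Z _.
rewrite cmodM cmodR gtr0_norm // mulrCA mulrC ler_wpM2r ?(ltW r0) //.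
by rewrite mulrAC ler_pdivrMr // ler_wpM2l ?(ltW e0) // lerDl.
Qed.

Lemma sdiff_uniq f w a b a' b' : sdiff f w a b -> sdiff f w a' b' ->
  a = a' /\ b = b'.
Proof.
move=> H H'; apply: rlin_inj => h; apply/eqP; rewrite -subr_eq0; apply/eqP.
apply: cmod_le0 => e e0; have e2 : 0 < e / 2 by rewrite divr_gt0.
have [d d0 Hd] := sdiff_deriv h H e2; have [d' d'0 Hd'] := sdiff_deriv h H' e2.
pose r := Num.min d d' / 2.
have m0 : 0 < Num.min d d' by rewrite lt_min d0.
have r0 : 0 < r by rewrite divr_gt0.
have := ltr_pdivrMr (Num.min d d') (Num.min d d') (ltr0n R 2 : 0 < 2).
have rm : r < Num.min d d' by rewrite /r; lra.
move: (rm); rewrite lt_min => /andP[rd rd'] _.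
have := Hd r r0 rd; have := Hd' r r0 rd'.
set q := _ / _ => h1 h2; have := cmod_distD q (rlin a b h) (rlin a' b' h).
rewrite (cmod_distC _ q); lra.
Qed.

(** The derivative is continuous: a short increment at [x] is approximated by the linear part at
    [x], and also by the one at [w] since [x] lies in the disc given by strictness at [w]. So the
    two linear parts are close. *)
Lemma sdiff_jet f (A B : C -> C) w : (forall x, sdiff f x (A x) (B x)) ->
  forall e : R, 0 < e -> exists2 d : R, 0 < d & forall x, cmod (x - w) < d ->
    cmod (A x - A w) <= e /\ cmod (B x - B w) <= e.
Proof.
move=> H e e0; have e2 : 0 < e / 2 by rewrite divr_gt0.
have [d d0 Hd] := H w _ e2; exists d => // x xd.
apply: rlin_small => h.
have [d' d'0 Hd'] := H x _ e2.
have xd' : 0 < d - cmod (x - w) by rewrite subr_gt0.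
have m0 : 0 < Num.min d' (d - cmod (x - w)) by rewrite lt_min d'0.
have [r r0] := small_scale h m0; rewrite lt_min => /andP[r1 r2].
have E : x + r%:C%C * h - x = r%:C%C * h by ring.
have X1 : cmod (x + r%:C%C * h - x) < d' by rewrite E.
have X2 : cmod (x - x) < d' by rewrite subrr cmod0.
have X3 : cmod (x + r%:C%C * h - w) < d.
  rewrite (_ : _ - w = (x - w) + r%:C%C * h); last by ring.
  by apply: le_lt_trans (cmodD _ _) _; rewrite -ltrBrDl.
have := Hd' _ _ X1 X2; have := Hd _ _ X3 xd; rewrite E.
set u := f _ - f _ => h1 h2;
have := cmod_distD u (rlin (A x) (B x) (r%:C%C * h)) (rlin (A w) (B w) (r%:C%C * h)).
rewrite (cmod_distC _ u).
have -> : rlin (A x) (B x) (r%:C%C * h) - rlin (A w) (B w) (r%:C%C * h)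
   = r%:C%C * rlin (A x - A w) (B x - B w) h.
  by rewrite -!rlinZ /rlin; ring.
have N : cmod (r%:C%C * h) = r * cmod h by rewrite cmodM cmodR gtr0_norm.
rewrite cmodM cmodR gtr0_norm // => h3.
rewrite -(ler_pM2l r0); move: h1 h2 h3; rewrite N.
by move=> h1 h2 h3; apply: le_trans h3 (le_trans (lerD h2 h1) _); lra.
Qed.

End StrictDerivative.

(** * Completeness and the inverse function theorem *)

Section OpenImage.
Variable R : realType.
Local Notation C := R[i].

(** With radii [e n = 2c/2^n] the intervals around [u n] are nested, and the supremum of their left
    ends lies in all of them. *)
Lemma geo_cauchy (u : nat -> R) (c : R) :
  (forall n, `|u n.+1 - u n| <= c / 2 ^+ n) ->
  exists l, forall n, `|l - u n| <= 2 * c / 2 ^+ n.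
Proof.
move=> H.
pose e n : R := 2 * c / 2 ^+ n.
have eS n : e n = c / 2 ^+ n + e n.+1.
  by rewrite /e exprS; field; rewrite expf_neq0 // pnatr_eq0.
have c0 : 0 <= c by have := le_trans (normr_ge0 _) (H 0); rewrite expr0 divr1.
have e0 n : 0 <= e n by rewrite divr_ge0 ?mulr_ge0 ?exprn_ge0.
have lo n : u n - e n <= u n.+1 - e n.+1.
  by have := eS n; have := H n; rewrite ler_norml => /andP[] ? ? ?; lra.
have hi n : u n.+1 + e n.+1 <= u n + e n.
  by have := eS n; have := H n; rewrite ler_norml => /andP[] ? ? ?; lra.
have loM n m : (n <= m)%N -> u n - e n <= u m - e m.
  by apply: (@homo_leq _ (fun n => u n - e n) <=%R) => // ? ? ?; apply: le_trans.
have hiM n m : (n <= m)%N -> u m + e m <= u n + e n.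
  move=> nm; rewrite -lerN2.
  apply: (@homo_leq _ (fun n => - (u n + e n)) <=%R) => // [? ? ?|i]; first exact: le_trans.
  by rewrite lerN2.
have LH n m : u n - e n <= u m + e m.
  have := loM _ _ (leq_maxl n m); have := hiM _ _ (leq_maxr n m).
  have := e0 (maxn n m); lra.
pose A := range (fun n => u n - e n).
have hA : has_sup A.
  split; first by exists (u 0 - e 0), 0.
  by exists (u 0 + e 0) => _ [n _ <-]; apply: LH.
exists (sup A) => n; rewrite ler_norml; apply/andP; split.
  have : u n - e n <= sup A by apply: sup_upper_bound => //; exists n.
  rewrite -/(e n); lra.
have : sup A <= u n + e n.
  by apply: ge_sup; [case: hA|move=> _ [m _ <-]; apply: LH].
rewrite -/(e n); lra.
Qed.

Lemma geo_cauchyC (u : nat -> C) (c : R) :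
  (forall n, cmod (u n.+1 - u n) <= c / 2 ^+ n) ->
  exists l, forall n, cmod (l - u n) <= 4 * c / 2 ^+ n.
Proof.
move=> H.
have [x Hx] : exists l, forall n, `|l - complex.Re (u n)| <= 2 * c / 2 ^+ n.
  apply: geo_cauchy => n; apply: le_trans (H n); apply: le_trans (cmod_Re _).
  by case: (u n.+1) => ? ?; case: (u n).
have [y Hy] : exists l, forall n, `|l - complex.Im (u n)| <= 2 * c / 2 ^+ n.
  apply: geo_cauchy => n; apply: le_trans (H n); apply: le_trans (cmod_Im _).
  by case: (u n.+1) => ? ?; case: (u n).
exists (Complex x y) => n; apply: le_trans (cmod_ReIm _) _.
have := Hx n; have := Hy n; case: (u n) => p q /= h1 h2.
apply: le_trans (lerD h2 h1) _; rewrite -mulrDl -mulrDl; lra.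
Qed.

Lemma half_pow_small (c : R) (e : R) : 0 < e -> exists n : nat, c / 2 ^+ n < e.
Proof.
move=> e0; pose n := Num.bound (c / e).
exists n; rewrite ltr_pdivrMr ?exprn_gt0 // mulrC -ltr_pdivrMr //.
have h := archi_boundP (normr_ge0 (c / e)).
case: (leP 0 (c / e)) => ce; last by apply: lt_le_trans ce _; rewrite exprn_ge0.
apply: lt_le_trans (archi_boundP ce) _; rewrite -natrX ler_nat.
by apply: ltnW; apply: ltn_expl.
Qed.

(* Newton iteration with the derivative at [w] frozen. *)
Lemma sdiff_open (f : C -> C) w a b (r : R) : sdiff f w a b ->
  cmod a != cmod b -> 0 < r -> exists2 s : R, 0 < s &
  forall y, cmod (y - f w) < s -> exists2 x, cmod (x - w) < r & f x = y.
Proof.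
move=> H ab r0.
(* [D] is the determinant of the real-linear map [rlin a b], and [M] below is its inverse. *)
pose D := a * conjc a - b * conjc b.
have D0 : D != 0.
  rewrite /D -!cmod_sqrE -rmorphB /= -cmod_gt0 cmodR normr_gt0 subr_eq0.
  by rewrite eqrXn2 ?cmod_ge0.
pose M k := rlin (conjc a / D) (- b / D) k.
have MK h : M (rlin a b h) = h.
  by rewrite /M /rlin; conj_push; rewrite /D in D0 *; field.
have KM k : rlin a b (M k) = k.
  have D1 : conjc a * a - conjc b * b = D by rewrite /D; ring.
  by rewrite /M /rlin; conj_push; rewrite D1; rewrite /D in D0 *; field.
have MB u v : M (u - v) = M u - M v by exact: rlinB.
pose K := cmod (conjc a / D) + cmod (- b / D) + 1.
have K0 : 0 < K by rewrite ltr_wpDl // addr_ge0 ?cmod_ge0.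
have MK' k : cmod (M k) <= K * cmod k.
  apply: le_trans (rlin_le _ _ _) _; rewrite ler_wpM2r ?cmod_ge0 //.
  by rewrite /K lerDl.
(* [K] bounds the inverse [M], so this precision makes [T] contract distances by 1/2. *)
have [d d0 Hd] := H (1 / (2 * K)) (divr_gt0 ltr01 (mulr_gt0 (ltr0n _ 2) K0)).
pose q := Num.min d r.
have q0 : 0 < q by rewrite lt_min d0.
(* The first Newton step has length at most [c = K |y - f w| < q/8]; the limit then lies within [4c]
   of [w], hence in the disc of radius [q]. *)
exists (q / (8 * K)); first by rewrite divr_gt0 // mulr_gt0.
move=> y; rewrite ltr_pdivlMr ?mulr_gt0 // => yq.
pose T x := x - M (f x - y).
have TL x x' : cmod (x - w) < d -> cmod (x' - w) < d ->
    cmod (T x - T x') <= cmod (x - x') / 2.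
  move=> h h'.
  have -> : T x - T x' = - M (f x - f x' - rlin a b (x - x')).
    by rewrite /T [M (_ - rlin _ _ _)]MB MK !MB; ring.
  rewrite cmodN; apply: le_trans (MK' _) _.
  have := Hd _ _ h h'; rewrite -(ler_pM2l K0) => h1; apply: le_trans h1 _.
  rewrite le_eqVlt; apply/orP; left; apply/eqP; field.
  by rewrite gt_eqF.
pose c := K * cmod (y - f w).
have c8 : 8 * c < q by rewrite /c; move: yq; rewrite mulrC -mulrA.
have c0 : 0 <= c by rewrite mulr_ge0 ?cmod_ge0 // ltW.
pose u n := iter n T w.
have pw n : 0 < 2 ^+ n :> R by rewrite exprn_gt0.
have p0 m : 0 <= 2 * c / 2 ^+ m.
  by apply: divr_ge0; [exact: mulr_ge0 | exact: ltW].
have uH n : cmod (u n - w) <= 2 * c - 2 * c / 2 ^+ n /\ cmod (u n.+1 - u n) <= c / 2 ^+ n.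
  elim: n => [|n [IH1 IH2]].
    rewrite /u /= subrr cmod0 expr0 !divr1 subrr; split=> //.
    rewrite /T addrAC subrr add0r cmodN; apply: le_trans (MK' _) _.
    by rewrite /c cmod_distC.
  have A : cmod (u n.+1 - w) <= 2 * c - 2 * c / 2 ^+ n.+1.
    apply: le_trans (cmod_distD (u n) _ _) _; apply: le_trans (lerD IH2 IH1) _.
    rewrite le_eqVlt; apply/orP; left; apply/eqP; rewrite exprS; field.
    by rewrite gt_eqF.
  split=> //.
  have lt m : 2 * c - 2 * c / 2 ^+ m < d.
    by have := p0 m; have : q <= d; [rewrite ge_min lexx | lra].
  apply: le_trans (TL _ _ (le_lt_trans A (lt _)) (le_lt_trans IH1 (lt _))) _.
  by rewrite exprS invfM mulrA mulrAC ler_pM2r ?invr_gt0.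
have [x Hx] := geo_cauchyC (fun n => (uH n).2).
have xw : cmod (x - w) < q.
  by have := Hx 0; rewrite expr0 divr1 /u /=; lra.
move: (xw); rewrite lt_min => /andP[xd xr].
exists x => //; apply/eqP; rewrite -subr_eq0 -(KM (f x - y)).
(* Since [M (f x - y) = x - T x], the limit [x] of the iterates has to be a fixed point of [T]. *)
suff -> : M (f x - y) = 0 by rewrite /rlin mulr0 rmorph0 mulr0 addr0.
rewrite (_ : M _ = x - T x); last by rewrite /T; ring.
apply: cmod_le0 => e e0.
have [n hn] := half_pow_small (8 * c) e0.
have und : cmod (u n - w) < d.
  have := (uH n).1; have : q <= d by rewrite ge_min lexx.
  by have := p0 n; lra.
apply: le_trans (cmod_distD (u n.+1) _ _) _.
have h1 := Hx n.+1; have h2 := TL _ _ und xd; have h3 := Hx n.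
have h4 : u n.+1 = T (u n) by [].
rewrite -h4 (cmod_distC (u n) x) in h2.
have E : 4 * c / 2 ^+ n.+1 = (4 * c / 2 ^+ n) / 2.
  by rewrite exprS; field; rewrite gt_eqF.
have E' : 8 * c / 2 ^+ n = 2 * (4 * c / 2 ^+ n) by ring.
rewrite E in h1; rewrite E' in hn; lra.
Qed.

End OpenImage.

(** * One-sided limits and blow-ups at 0 *)

Section Limits.
Variable R : realType.
Local Notation C := R[i].
Implicit Types (u v : R -> C) (l k : C).

(* Limit at [0+]. *)
Definition cv0 u l := forall e : R, 0 < e -> exists2 d : R, 0 < d &
  forall r, 0 < r -> r < d -> cmod (u r - l) <= e.

Lemma cv0_const l : cv0 (fun=> l) l.
Proof. by move=> e e0; exists 1 => // r _ _; rewrite subrr cmod0 ltW. Qed.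

Lemma cv0_ext u v l : (forall r, 0 < r -> u r = v r) -> cv0 u l -> cv0 v l.
Proof.
by move=> E H e /H[d d0 Hd]; exists d => // r r0 rd; rewrite -E // Hd.
Qed.

Lemma cv0_bounded u l : cv0 u l -> exists2 d : R, 0 < d &
  forall r, 0 < r -> r < d -> cmod (u r) <= cmod l + 1.
Proof.
move=> /(_ 1 ltr01)[d d0 H]; exists d => // r r0 rd.
have := cmodD (u r - l) l; rewrite subrK; have := H r r0 rd; lra.
Qed.

Lemma cv0D u v l k : cv0 u l -> cv0 v k -> cv0 (fun r => u r + v r) (l + k).
Proof.
move=> H K e e0; have e2 : 0 < e / 2 by rewrite divr_gt0.
have [d d0 Hd] := H _ e2; have [d' d'0 Hd'] := K _ e2.
exists (Num.min d d'); first by rewrite lt_min d0.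
move=> r r0; rewrite lt_min => /andP[rd rd'].
rewrite (_ : _ - _ = (u r - l) + (v r - k)); last by ring.
apply: le_trans (cmodD _ _) _; have := Hd r r0 rd; have := Hd' r r0 rd'; lra.
Qed.

Lemma cv0N u l : cv0 u l -> cv0 (fun r => - u r) (- l).
Proof.
move=> H e /H[d d0 Hd]; exists d => // r r0 rd.
by rewrite -opprD cmodN Hd.
Qed.

Lemma cv0J u l : cv0 u l -> cv0 (fun r => conjc (u r)) (conjc l).
Proof.
move=> H e /H[d d0 Hd]; exists d => // r r0 rd.
by rewrite -(rmorphB (@conjc R)) /= cmodJ Hd.
Qed.

Lemma cv0M u v l k : cv0 u l -> cv0 v k -> cv0 (fun r => u r * v r) (l * k).
Proof.
move=> H K e e0; pose M := cmod l + 1 + cmod k.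
have M0 : 0 < M by have := cmod_ge0 l; have := cmod_ge0 k; rewrite /M; lra.
have eM : 0 < e / M by rewrite divr_gt0.
have [d1 d10 H1] := H _ eM; have [d2 d20 H2] := K _ eM.
have [d3 d30 H3] := cv0_bounded H.
exists (Num.min d1 (Num.min d2 d3)); first by rewrite !lt_min d10 d20.
move=> r r0; rewrite !lt_min => /andP[r1 /andP[r2 r3]].
rewrite (_ : _ - _ = u r * (v r - k) + (u r - l) * k); last by ring.
apply: le_trans (cmodD _ _) _; rewrite !cmodM.
have -> : e = (cmod l + 1) * (e / M) + (e / M) * cmod k.
  by rewrite [e / M * _]mulrC -mulrDl -/M mulrC divfK // gt_eqF.
by apply: lerD; apply: ler_pM; rewrite ?cmod_ge0 ?H1 ?H2 ?H3.
Qed.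

Lemma cv0_neq0 u l : cv0 u l -> l != 0 -> exists2 r : R, 0 < r & u r != 0.
Proof.
move=> H l0; have L : 0 < cmod l / 2 by rewrite divr_gt0 // cmod_gt0.
have [d d0 Hd] := H _ L; exists (d / 2); first by rewrite divr_gt0.
have rd : d / 2 < d by lra.
have := Hd _ (divr_gt0 d0 (ltr0n _ 2)) rd; set x := u _ => h.
apply/eqP => x0; move: h; rewrite x0 sub0r cmodN.
by move: L; lra.
Qed.

Lemma cv0_mulr_small u l (d : R) : cv0 u l -> 0 < d -> exists2 d' : R, 0 < d' &
  forall r, 0 < r -> r < d' -> cmod (r%:C%C * u r) < d.
Proof.
move=> /cv0_bounded[d1 d10 H1] d0.
have L : 0 < cmod l + 1 by rewrite ltr_wpDl ?cmod_ge0.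
exists (Num.min d1 (d / (cmod l + 1))); first by rewrite lt_min d10 divr_gt0.
move=> r r0; rewrite lt_min ltr_pdivlMr // => /andP[r1 r2].
rewrite cmodM cmodR gtr0_norm //; apply: le_lt_trans r2.
by rewrite ler_wpM2l ?(ltW r0) // H1.
Qed.

(** Zooming in at a fixed point replaces [f] by its linear part. The argument [u] may vary with the
    scale, so that blow-ups can be composed. *)
Lemma cv0_blowup (f : C -> C) a b u l : f 0 = 0 -> sdiff f 0 a b -> cv0 u l ->
  cv0 (fun r => f (r%:C%C * u r) / r%:C%C) (rlin a b l).
Proof.
move=> f0 H U.
have V : cv0 (fun r => rlin a b (u r)) (rlin a b l).
  apply: cv0D; apply: cv0M; rewrite -?/(cv0 _ _); try exact: cv0_const => //.
    exact: U.
  exact: cv0J.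
suff W : cv0 (fun r => f (r%:C%C * u r) / r%:C%C - rlin a b (u r)) 0.
  rewrite -[rlin a b l]add0r; apply: cv0_ext (cv0D W V) => r _; exact: subrK.
move=> e e0; have [d1 d10 H1] := cv0_bounded U.
have L : 0 < cmod l + 1 by rewrite ltr_wpDl ?cmod_ge0.
have [d2 d20 H2] := H _ (divr_gt0 e0 L).
have [d3 d30 H3] := cv0_mulr_small U d20.
exists (Num.min d1 d3); first by rewrite lt_min d10.
move=> r r0; rewrite lt_min => /andP[r1 r3]; rewrite subr0.
have X1 : cmod (r%:C%C * u r - 0) < d2 by rewrite subr0 H3.
have X2 : cmod (0 - 0 : C) < d2 by rewrite subr0 cmod0.
have := H2 _ _ X1 X2; rewrite f0 !subr0 rlinZ => X.
have rC : r%:C%C != 0 :> C by rewrite -cmod_gt0 cmodR gtr0_norm.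
rewrite (_ : _ - _ = (f (r%:C%C * u r) - r%:C%C * rlin a b (u r)) / r%:C%C); last first.
  by field.
rewrite cmodM cmodV cmodR gtr0_norm // ler_pdivrMr //; apply: le_trans X _.
rewrite cmodM cmodR gtr0_norm // mulrCA mulrC ler_wpM2r ?(ltW r0) //.
by rewrite mulrAC ler_pdivrMr // ler_wpM2l ?(ltW e0) // H1.
Qed.

Lemma cv0_jet (f A B : C -> C) u l : (forall x, sdiff f x (A x) (B x)) ->
  cv0 u l -> cv0 (fun r => A (r%:C%C * u r)) (A 0) /\
             cv0 (fun r => B (r%:C%C * u r)) (B 0).
Proof.
move=> H U.
have E : forall e : R, 0 < e -> exists2 d : R, 0 < d &
  forall r, 0 < r -> r < d -> cmod (A (r%:C%C * u r) - A 0) <= e /\ cmod (B (r%:C%C * u r) - B 0) <= e.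
  move=> e e0; have [d d0 Hd] := sdiff_jet 0 H e0.
  have [d' d'0 Hd'] := cv0_mulr_small U d0.
  by exists d' => // r r0 rd; apply: Hd; rewrite subr0 Hd'.
by split => e /E[d d0 Hd]; exists d => // r r0 rd; have [] := Hd r r0 rd.
Qed.

End Limits.

(** * Induction along the unit interval *)

Section RealInduction.
Variable R : realType.

(** The supremum of the [t] for which [P] holds on [[0, t)] cannot be an obstruction. This serves
    both as a mean value argument and as connectedness of segments. *)
Lemma real_induction01 (P : R -> Prop) :
  (forall t : R, 0 <= t <= 1 -> (forall s : R, 0 <= s -> s < t -> P s) ->
     exists2 d : R, 0 < d & forall s : R, 0 <= s <= 1 -> t <= s -> s < t + d -> P s) ->
  forall t : R, 0 <= t <= 1 -> P t.
Proof.
move=> H.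
pose A := [set t : R | 0 <= t <= 1 /\ forall s, 0 <= s -> s < t -> P s].
have A0 : A 0 by split; [rewrite lexx ler01 | move=> s s0; rewrite ltNge s0].
have hA : has_sup A.
  by split; [exists 0 | exists 1 => t [/andP[_ ?] _]].
pose T := sup A.
have T0 : 0 <= T by apply: sup_upper_bound.
have T1 : T <= 1 by apply: ge_sup; [exists 0 | move=> t [/andP[_ ?] _]].
have PT s : 0 <= s -> s < T -> P s.
  move=> s0; rewrite -subr_gt0 => sT; have [t [_ At] st] := sup_adherent sT hA.
  by apply: At => //; move: st; rewrite -/T opprB addrCA subrr addr0.
have T01 : 0 <= T <= 1 by rewrite T0.
have [d d0 Hd] := H T T01 PT.
have P' s : 0 <= s <= 1 -> s < T + d -> P s.
  move=> s01 sd; have [sT|Ts] := ltP s T; last exact: Hd.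
  by apply: PT => //; case/andP: s01.
move=> t t01; apply: (P' t) => //.
apply: le_lt_trans (_ : 1 < _); first by case/andP: t01.
rewrite ltNge; apply/negP => dT.
have : A (T + d).
  split; first by rewrite dT addr_ge0 // ltW.
  by move=> s s0 sd; apply: P' => //; rewrite s0 (le_trans (ltW sd)).
move=> /(sup_upper_bound hA); rewrite -/T; lra.
Qed.

(** For every [e > 0], real induction gives that [f] moves by at most [e t] along the segment up to
    time [t]. *)
Lemma sdiff0_cst (f : R[i] -> R[i]) (x y : R[i]) :
  (forall t : R, 0 <= t <= 1 -> sdiff f (x + t%:C%C * (y - x)) 0 0) -> f x = f y.
Proof.
move=> H; apply/eqP; rewrite eq_sym -subr_eq0; apply/eqP; apply: cmod_le0 => e e0.
pose K := cmod (y - x) + 1.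
have K0 : 0 < K by rewrite ltr_wpDl ?cmod_ge0.
pose p (t : R) := x + t%:C%C * (y - x).
have pB s t : p s - p t = (s - t)%:C%C * (y - x) by rewrite /p rmorphB /=; ring.
have pB' s t : cmod (p s - p t) <= `|s - t| * K.
  by rewrite pB cmodM cmodR ler_wpM2l // lerDl.
have L t : 0 <= t <= 1 -> exists2 d : R, 0 < d & forall s s',
    `|s - t| < d -> `|s' - t| < d -> cmod (f (p s) - f (p s')) <= e * `|s - s'|.
  move=> /H /(_ _ (divr_gt0 e0 K0))[d d0 Hd].
  exists (d / K); first by rewrite divr_gt0.
  move=> s s'; rewrite !ltr_pdivlMr // => h h'.
  have := Hd _ _ (le_lt_trans (pB' _ _) h) (le_lt_trans (pB' _ _) h').
  rewrite /rlin !mul0r addr0 subr0 => X; apply: le_trans X _.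
  rewrite -mulrA ler_wpM2l ?(ltW e0) // mulrC ler_pdivrMr //.
have : forall t, 0 <= t <= 1 -> cmod (f (p t) - f (p 0)) <= e * t.
  apply: real_induction01 => t t01 IH.
  have [d d0 Hd] := L t t01; exists d => // s s01 ts sd.
  have hs : `|s - t| < d by rewrite ger0_norm ?subr_ge0 // ltrBlDl.
  have [t0|t0] := eqVneq t 0.
    have := Hd s 0 hs; rewrite t0 subrr normr0 subr0 => /(_ d0).
    by rewrite ger0_norm //; case/andP: s01.
  have tp : 0 < t by rewrite lt0r t0; case/andP: t01.
  (* A time strictly before [t] where the bound is already known, close enough to [t] for the local
     estimate to reach from it to [s]. *)
  pose s' := Num.max 0 (t - d / 2).
  have s'0 : 0 <= s' by rewrite le_max lexx.
  have s't : s' < t by rewrite gt_max tp /=; lra.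
  have hs' : `|s' - t| < d.
    rewrite ltr0_norm ?subr_lt0 // opprB.
    have : t - d / 2 <= s' by rewrite le_max lexx orbT.
    lra.
  have := Hd s s' hs hs'; have := IH s' s'0 s't.
  rewrite [`|s - s'|]ger0_norm; last by rewrite subr_ge0; lra.
  move=> h1 h2; apply: le_trans (cmod_distD (f (p s')) _ _) _.
  by apply: le_trans (lerD h2 h1) _; rewrite -mulrDr subrK.
move=> /(_ 1); rewrite ler01 lexx /p mul1r mul0r addr0 => /(_ isT).
by rewrite mulr1 (_ : x + (y - x) = y) //; ring.
Qed.

End RealInduction.

(** * Cross ratios under a planar group *)

Section PlanarGroup.
Variable R : realType.
Local Notation C := R[i].

(* The stabiliser of infinity, acting on the plane; the last clause records
   the conjugate by [w => -1/w] of an element fixing 0. *)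
Record planar_group (S : set (C -> C)) : Prop := PlanarGroup {
  planar_comp : forall f g, S f -> S g -> S (f \o g);
  planar_inv : forall f, S f -> exists g, [/\ S g, cancel f g & cancel g f];
  planar_affine : forall a b, a != 0 -> S (fun w => a * w + b);
  planar_sdiff : forall f, S f -> forall w,
    exists a b, sdiff f w a b /\ cmod b < cmod a;
  planar_conj_inv : forall f, S f -> f 0 = 0 -> exists2 k, S k &
    forall q, q != 0 -> k q = - (f (- q^-1))^-1 }.

Variable S : set (C -> C).
Hypothesis SG : planar_group S.

(** Elements of [S] also fix infinity, so [z] stands for the cross ratio of the quadruple formed by
    0, 1, infinity and [z]. *)
Definition orb z w := exists h, [/\ S h, h 0 = 0, h 1 = 1 & h z = w].

Lemma planar_inj f : S f -> injective f.
Proof. by move=> /(planar_inv SG)[g [_ /can_inj]]. Qed.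

Lemma orb_refl z : orb z z.
Proof.
exists (fun w => 1 * w + 0); split; rewrite ?mul1r ?addr0 //.
by apply: planar_affine => //; exact: oner_neq0.
Qed.

Lemma orb_sym z w : orb z w -> orb w z.
Proof.
case=> h [Sh h0 h1 hz]; have [g [Sg hK gK]] := planar_inv SG Sh.
exists g; split=> //; first by rewrite -{1}h0 hK.
  by rewrite -{1}h1 hK.
by rewrite -hz hK.
Qed.

Lemma orb_trans z w v : orb z w -> orb w v -> orb z v.
Proof.
case=> h [Sh h0 h1 hz] [k [Sk k0 k1 kw]].
by exists (k \o h); split; rewrite /= ?h0 ?h1 ?hz //; apply: planar_comp.
Qed.

(** Sandwiching [k] between the affine maps that normalise [(a, b)] and [(k a, k b)] to [(0, 1)]
    gives an element fixing 0 and 1. This is the source of all orbit points below. *)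
Lemma orb_ratio k a b z : S k -> a != b ->
  orb z ((k (a + z * (b - a)) - k a) / (k b - k a)).
Proof.
move=> Sk ab; have kab : k b - k a != 0.
  by rewrite subr_eq0; apply: contra ab => /eqP/(planar_inj Sk) ->.
exists ((fun w => (k b - k a)^-1 * w + - k a / (k b - k a)) \o
        (k \o (fun w => (b - a) * w + a))); split => /=.
- apply: (planar_comp SG); first by apply: planar_affine; rewrite ?invr_eq0.
  apply: (planar_comp SG) => //; apply: planar_affine => //.
  by rewrite subr_eq0 eq_sym.
- by rewrite mulr0 add0r; ring.
- by rewrite mulr1 subrK; field.
- by rewrite [(b - a) * z + a]addrC [z * _]mulrC; ring.
Qed.

Definition interior_orb z := exists w (r : R), [/\ orb z w, 0 < r &
  forall w', cmod (w' - w) < r -> orb z w'].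

Lemma interior_orb_trans z w : orb z w -> interior_orb w -> interior_orb z.
Proof.
move=> zw [v [r [wv r0 H]]]; exists v, r; split => //; first exact: orb_trans wv.
by move=> w' /H; apply: orb_trans.
Qed.

(** A group element carries [w] to the interior point; by its continuity the neighbourhood pulls
    back. Hence an orbit with an interior point is open. *)
Lemma interior_open z w : interior_orb z -> orb z w ->
  exists2 r : R, 0 < r & forall w', cmod (w' - w) < r -> orb z w'.
Proof.
move=> [v [r [zv r0 H]]] zw.
have [h [Sh h0 h1 hw]] := orb_trans (orb_sym zw) zv.
have [a [b [hd _]]] := planar_sdiff SG Sh w.
have [d d0 Hd] := sdiff_cont hd r0.
exists d => // w' /Hd; rewrite hw => /H zw'.
by apply: orb_trans zw' _; apply: orb_sym; exists h.
Qed.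

Lemma interior_sdiff (P : C -> C) c a b z (r : R) : 0 < r ->
  (forall x, cmod (x - c) < r -> orb z (P x)) -> sdiff P c a b ->
  cmod a != cmod b -> interior_orb z.
Proof.
move=> r0 H Pd ab; have [s s0 Hs] := sdiff_open Pd ab r0.
exists (P c), s; split=> //; first by apply: H; rewrite subrr cmod0.
by move=> w' /Hs[x xr <-]; apply: H.
Qed.

Definition generic (z : C) := (z != 0) && (z != 1).

(** All orbits met along the segment are open, so being in the orbit of [z] is an open and closed
    condition on the parameter. *)
Lemma orb_segment z w : (forall v, generic v -> interior_orb v) ->
  (forall t : R, 0 <= t <= 1 -> generic (z + t%:C%C * (w - z))) -> orb z w.
Proof.
move=> H G; pose p (t : R) := z + t%:C%C * (w - z).
have pB s t : p s - p t = (s - t)%:C%C * (w - z) by rewrite /p rmorphB /=; ring.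
have K0 : 0 < cmod (w - z) + 1 by rewrite ltr_wpDl ?cmod_ge0.
suff : forall t : R, 0 <= t <= 1 -> orb z (p t).
  move=> /(_ 1); rewrite ler01 lexx /p mul1r (_ : z + (w - z) = w); last by ring.
  by apply.
apply: real_induction01 => t t01 IH.
have [r r0 Hr] := interior_open (H _ (G t t01)) (orb_refl _).
have Hp s : `|s - t| < r / (cmod (w - z) + 1) -> orb (p t) (p s).
  rewrite ltr_pdivlMr // => h; apply: Hr; rewrite -/(p t) pB cmodM cmodR.
  by apply: le_lt_trans h; rewrite ler_wpM2l // lerDl.
set d := _ / _ in Hp; have d0 : 0 < d by rewrite divr_gt0.
exists d => // s s01 ts sd.
have hs : orb (p t) (p s).
  by apply: Hp; rewrite ger0_norm ?subr_ge0 // ltrBlDl.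
apply: orb_trans hs.
have [t0|t0] := eqVneq t 0.
  by rewrite t0 /p mul0r addr0; exact: orb_refl.
have tp : 0 < t by rewrite lt0r t0; case/andP: t01.
pose s' := Num.max 0 (t - d / 2).
have s'0 : 0 <= s' by rewrite le_max lexx.
have s't : s' < t by rewrite gt_max tp /=; lra.
apply: orb_trans (IH s' s'0 s't) (orb_sym _); apply: Hp.
rewrite ltr0_norm ?subr_lt0 // opprB.
have : t - d / 2 <= s' by rewrite le_max lexx orbT.
lra.
Qed.

Lemma orb_all : (forall v, generic v -> interior_orb v) ->
  forall z w, generic z -> generic w -> orb z w.
Proof.
move=> H.
(* The segment from a non-real point to 1/2 meets the real line only at 1/2; a real point first goes
   to i by a segment leaving the real line at once. *)
pose c : C := Complex (1 / 2) 0.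
have nonreal z : complex.Im z != 0 -> orb z c.
  move=> z0; apply: orb_segment => // t /andP[t0 t1].
  case: z z0 => x y /= y0; rewrite /generic !eq_complex /=.
  have [->|tn] := eqVneq t 1.
    by apply/andP; split; apply/nandP; left; apply/eqP; lra.
  have Y : y + (t * (0 - y) + 0 * (1 / 2 - x)) != 0.
    rewrite (_ : _ + _ = (1 - t) * y); last by ring.
    by rewrite mulf_neq0 // subr_eq0 eq_sym.
  by apply/andP; split; apply/nandP; right.
have ic : orb 'i%C c by apply: nonreal; rewrite /= oner_neq0.
suff all z : generic z -> orb z c.
  by move=> z w /all zc /all wc; apply: orb_trans zc (orb_sym wc).
move=> gz; have [z0|] := eqVneq (complex.Im z) 0; last exact: nonreal.
apply: orb_trans ic; apply: orb_segment => // t /andP[t0 t1].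
case: z z0 gz => x y /= ->; rewrite /generic !eq_complex /= !eqxx !andbT => gz.
have [->|tn] := eqVneq t 0; first by rewrite !mul0r subrr !addr0 eqxx !andbT.
have Y : 0 + (t * (1 - 0) + 0 * (0 - x)) != 0.
  by rewrite add0r mul0r addr0 subr0 mulr1.
by apply/andP; split; apply/nandP; right.
Qed.

End PlanarGroup.

(** * Additive maps differentiable at 0 *)

Section Additive.
Variable R : realType.
Local Notation C := R[i].

(** Additivity gives [g w = 2^n g (w / 2^n)], and the right side tends to the derivative at 0
    applied to [w]. *)
Lemma additive_sdiff (g : C -> C) a b : (forall x y, g (x + y) = g x + g y) ->
  sdiff g 0 a b -> forall w, g w = rlin a b w.
Proof.
move=> gD H w.
have g0 : g 0 = 0 by apply: (addrI (g 0)); rewrite -gD !addr0.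
have gh x : g x = 2 * g (x / 2).
  rewrite -[in LHS](_ : x / 2 + x / 2 = x); last by field.
  by rewrite gD; ring.
have g2 n x : g x = 2 ^+ n * g (x / 2 ^+ n).
  elim: n x => [|n IH] x; first by rewrite expr0 divr1 mul1r.
  rewrite gh IH exprS -[RHS]mulrA; congr (_ * (_ * g _)).
  by field; rewrite expf_neq0 // pnatr_eq0.
apply/eqP; rewrite -subr_eq0; apply/eqP; apply: cmod_le0 => e e0.
have K0 : 0 < cmod w + 1 by rewrite ltr_wpDl ?cmod_ge0.
have [d d0 Hd] := H _ (divr_gt0 e0 K0).
have [n hn] := half_pow_small (cmod w) d0.
have E : w / 2 ^+ n = ((2 ^+ n)^-1)%:C%C * w :> C.
  by rewrite fmorphV rmorphXn rmorph_nat mulrC.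
have p0 : 0 < 2 ^+ n :> R by rewrite exprn_gt0.
have N : cmod (w / 2 ^+ n) = cmod w / 2 ^+ n.
  by rewrite E cmodM cmodR ger0_norm ?invr_ge0 ?exprn_ge0 // mulrC.
have X1 : cmod (w / 2 ^+ n - 0) < d by rewrite subr0 N.
have X2 : cmod (0 - 0 : C) < d by rewrite subr0 cmod0.
have := Hd _ _ X1 X2; rewrite !subr0 g0 subr0 N => X.
have -> : g w - rlin a b w = 2 ^+ n * (g (w / 2 ^+ n) - rlin a b (w / 2 ^+ n)).
  rewrite mulrBr -g2 E rlinZ; congr (_ - _).
  by rewrite fmorphV rmorphXn rmorph_nat mulrA divff ?mul1r // expf_neq0 // pnatr_eq0.
rewrite cmodM (_ : cmod (2 ^+ n) = 2 ^+ n); last first.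
  by rewrite -[2 : C](rmorph_nat (real_complex R)) -rmorphXn cmodR ger0_norm ?exprn_ge0.
apply: le_trans (ler_wpM2l (ltW p0) X) _.
rewrite [leLHS](_ : _ = e * (cmod w / (cmod w + 1))); last by field; rewrite !gt_eqF.
by rewrite -[leRHS]mulr1 ler_wpM2l ?(ltW e0) // ler_pdivrMr // mul1r lerDl.
Qed.

End Additive.

(** * The conformal case *)

Section Interior.
Variable R : realType.
Local Notation C := R[i].
Variable S : set (C -> C).
Hypothesis SG : planar_group S.

Definition hol (f : C -> C) w := exists a, sdiff f w a 0.

Lemma hol_affine (a b w : C) : hol (fun x => a * x + b) w.
Proof.
exists a; apply: sdiff_eq (sdiffD (sdiffM (sdiff_const a w) (sdiff_id w)) (sdiff_const b w)) _ _;
ring.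
Qed.

Lemma hol_comp f g w : hol f (g w) -> hol g w -> hol (f \o g) w.
Proof.
move=> [a ha] [b hb]; exists (a * b).
by apply: sdiff_eq (sdiff_comp ha hb) _ _; rewrite ?conjc0; ring.
Qed.

Lemma hol_div f g w : hol f w -> hol g w -> g w != 0 ->
  hol (fun x => f x / g x) w.
Proof.
move=> [a ha] [b hb] gw.
exists (a / g w - f w * (b / g w ^+ 2)).
by apply: sdiff_eq (sdiffM ha (sdiff_comp (sdiffV gw) hb)) _ _; rewrite /= ?conjc0; ring.
Qed.

Lemma hol_subc f c w : hol f w -> hol (fun x => f x - c) w.
Proof.
move=> [a ha]; exists a.
by apply: sdiff_eq (sdiffD ha (sdiff_const (- c) w)) _ _; ring.
Qed.

(* The ratio along the dilates [(a, a + c h, a + c z h)] is holomorphic in [c]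
   and tends to [z] as [c -> 0], so either it is an open map somewhere or it
   is constantly [z]. *)
Lemma conformal_interior f z : S f -> (forall w, hol f w) ->
  interior_orb S z \/ (forall a h, f (a + z * h) - f a = z * (f (a + h) - f a)).
Proof.
move=> Sf hf; have [I|nI] := EM (interior_orb S z); [by left | right => a h].
have [->|h0] := eqVneq h 0; first by rewrite mulr0 addr0 subrr mulr0.
pose N c := f (z * h * c + a) - f a; pose D c := f (h * c + a) - f a.
pose P c := N c / D c.
have D0 c : c != 0 -> D c != 0.
  move=> c0; rewrite subr_eq0; apply: contra c0 => /eqP /(planar_inj SG Sf) /eqP.
  by rewrite -subr_eq0 addrK mulf_eq0 (negPf h0).
have hP c : c != 0 -> hol P c.
  move=> c0; apply: hol_div; last exact: D0.
    by apply: hol_subc; apply: (hol_comp (g := fun c => z * h * c + a)) => //; exact: hol_affine.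
  by apply: hol_subc; apply: (hol_comp (g := fun c => h * c + a)) => //; exact: hol_affine.
(* A nonzero complex derivative of [P] would make the orbit of [z] contain a disc, against [nI]. *)
have P0 c : c != 0 -> sdiff P c 0 0.
  move=> c0; have [al Hal] := hP c c0.
  have [a0|a0] := eqVneq al 0; first by rewrite a0 in Hal.
  case: nI; apply: (interior_sdiff _ _ Hal (r := cmod c)).
  - by rewrite cmod_gt0.
  - move=> x xc; have x0 : x != 0.
      by apply: contraTneq xc => ->; rewrite sub0r cmodN ltxx.
    have := orb_ratio SG (a := a) (b := h * x + a) z Sf.
    rewrite (_ : a + z * (h * x + a - a) = z * h * x + a); last by ring.
    by apply; rewrite eq_sym -subr_eq0 addrK mulf_neq0.
  - by rewrite cmod0 cmod_eq0.
(* The segment from [r] to 1 avoids the excluded point 0, so [P 1] can be computed as the limit of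
   [P] at 0+, where the derivative of [f] at [a] cancels and leaves [z]. *)
have Pr (r : R) : 0 < r -> r <= 1 -> P r%:C%C = P 1.
  move=> r0 r1; apply: sdiff0_cst => t /andP[t0 t1]; apply: P0.
  have -> : r%:C%C + t%:C%C * (1 - r%:C%C) = (r + t * (1 - r))%:C%C :> C.
    by rewrite rmorphD rmorphM rmorphB rmorph1.
  rewrite -cmod_gt0 cmodR normr_gt0 gt_eqF //.
  have : 0 <= t * (1 - r) by rewrite mulr_ge0 // subr_ge0.
  lra.
have [al [be [sal bel]]] := planar_sdiff SG Sf a.
have [al' sal'] := hf a.
have [E1 E2] := sdiff_uniq sal sal'; rewrite -{}E1 {}E2 cmod0 in sal' bel.
have al0 : al != 0 by rewrite -cmod_gt0.
have P1z : P 1 = z.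
  suff : rlin al 0 (z * h) - P 1 * rlin al 0 h = 0.
    rewrite /rlin !mul0r !addr0 => /eqP.
    rewrite (_ : _ - _ = (z - P 1) * (al * h)); last by ring.
    by rewrite !mulf_eq0 (negPf h0) (negPf al0) !orbF subr_eq0 => /eqP.
  apply: cmod_le0 => e e0.
  have K0 : 0 < cmod (P 1) + 1 by rewrite ltr_wpDl ?cmod_ge0.
  have e' : 0 < e / (cmod (P 1) + 1) by rewrite divr_gt0.
  have [d1 d10 H1] := sdiff_deriv (z * h) sal' e'.
  have [d2 d20 H2] := sdiff_deriv h sal' e'.
  pose m := Num.min 1 (Num.min d1 d2); pose r := m / 2.
  have m0 : 0 < m by rewrite !lt_min ltr01 d10.
  have r0 : 0 < r by rewrite divr_gt0.
  have : r < m by rewrite /r; lra.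
  rewrite !lt_min => /andP[r1 /andP[rd1 rd2]].
  have := H1 r r0 rd1; have := H2 r r0 rd2.
  have rC : r%:C%C != 0 :> C by rewrite -cmod_gt0 cmodR gtr0_norm.
  have E : f (a + r%:C%C * (z * h)) - f a = P 1 * (f (a + r%:C%C * h) - f a).
    have -> : a + r%:C%C * (z * h) = z * h * r%:C%C + a by ring.
    have -> : a + r%:C%C * h = h * r%:C%C + a by ring.
    by rewrite -(Pr r r0 (ltW r1)) divfK // D0.
  rewrite E; set q := f _ - f a => h2 h1.
  have -> : rlin al 0 (z * h) - P 1 * rlin al 0 h =
    P 1 * (q / r%:C%C - rlin al 0 h) - (P 1 * q / r%:C%C - rlin al 0 (z * h)) by ring.
  apply: le_trans (cmodB _ _) _; rewrite cmodM.
  apply: le_trans (lerD (ler_wpM2l (cmod_ge0 _) h2) h1) _.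
  by rewrite le_eqVlt; apply/orP; left; apply/eqP; field; rewrite gt_eqF.
have E := divfK (D0 1 (oner_neq0 _)) (N 1).
rewrite -/(P 1) P1z /N /D !mulr1 in E.
by rewrite [a + z * h]addrC [a + h]addrC.
Qed.

(** Up to a constant [f] respects the combination [(1 - z) x + z y]. Setting [x] or [y] to 0 shows
    that it commutes with multiplication by [z] and by [1 - z]; dividing by these nonzero numbers
    gives additivity. *)
Lemma ratio_preserving_affine f z : generic z -> (forall w, hol f w) ->
  (forall a h, f (a + z * h) - f a = z * (f (a + h) - f a)) ->
  exists a b, forall w, f w = a * w + b.
Proof.
move=> /andP[z0 z1] hf H.
pose g w := f w - f 0.
have E x y : g ((1 - z) * x + z * y) = (1 - z) * g x + z * g y.
  have := H x (y - x); rewrite (_ : x + z * (y - x) = (1 - z) * x + z * y); last by ring.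
  rewrite (_ : x + (y - x) = y); last by ring.
  by rewrite /g => /eqP; rewrite subr_eq => /eqP ->; ring.
have g0 : g 0 = 0 by rewrite /g subrr.
have Ez y : g (z * y) = z * g y by have := E 0 y; rewrite mulr0 add0r g0 mulr0 add0r.
have Ez' y : g ((1 - z) * y) = (1 - z) * g y by have := E y 0; rewrite mulr0 addr0 g0 mulr0 addr0.
have gD x y : g (x + y) = g x + g y.
  have := E (x / (1 - z)) (y / z); rewrite -Ez -Ez'.
  rewrite !(mulrC (1 - z)) !(mulrC z) !divfK //.
  by rewrite subr_eq0 eq_sym.
have [a ha] : hol g 0 by apply: hol_subc.
exists a, (f 0) => w; have := additive_sdiff gD ha w.
by rewrite /g /rlin mul0r addr0 => /eqP; rewrite subr_eq => /eqP.
Qed.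

End Interior.

(** * The non-conformal case *)

Section Nonconformal.
Variable R : realType.
Local Notation C := R[i].
Variable S : set (C -> C).
Hypothesis SG : planar_group S.
Variables (f A B : C -> C) (m : R).
Hypotheses (Sf : S f) (f0 : f 0 = 0).
Hypotheses (fAB : forall w, sdiff f w (A w) (B w)).
Hypotheses (A0 : A 0 = 1) (B0 : B 0 = m%:C%C) (m0 : 0 < m) (m1 : m < 1).

Let sd0 : sdiff f 0 1 m%:C%C. Proof. by have := fAB 0; rewrite A0 B0. Qed.

Let cC (r : R) : 0 < r -> r%:C%C != 0 :> C.
Proof. by move=> r0; rewrite -cmod_gt0 cmodR gtr0_norm. Qed.

Let cvA u l : cv0 u l -> cv0 (fun r => A (r%:C%C * u r)) 1.
Proof. by move=> H; rewrite -A0; have [] := cv0_jet fAB H. Qed.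

Let cvB u l : cv0 u l -> cv0 (fun r => B (r%:C%C * u r)) m%:C%C.
Proof. by move=> H; rewrite -B0; have [] := cv0_jet fAB H. Qed.

(** [L] is the rotation, up to scale, between the two applications of [f]. As [h] is imaginary,
    [h c + h conj c] depends on the real part of [c] alone. The bound on [h] keeps the perturbed
    factors away from 0 for [|c| < 1], and [L^2] non-real makes the two perturbations
    independent. *)
Variables (L h : C).
Hypotheses (hJ : conjc h = - h) (h0 : h != 0) (h1 : cmod h <= 1 / 2).
Hypotheses (L0 : L != 0) (L1 : L ^+ 2 != conjc L ^+ 2).

(* [two_step z r] applies [f] to [r z], rotates and applies [f] again; the
   real and imaginary parts of the parameter perturb the two rotations by
   [1 + i s] and [1 + i t].  The blow-up of its value at 0 by the factor
   [1 / r] is [Nv], and [Na], [Nb] are the blow-ups of its derivative. *)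
Let two_step (z : C) (r : R) (c : C) : C :=
  f (L * (1 + c / 2 + - conjc c / 2) * f (r%:C%C * z * (1 + h * c + h * conjc c))).

(** [V] is the blow-up of the inner application of [f]. Its derivative in [c] has [r Va] as both
    coefficients, since only the real part of [c] enters there; [Qa] and [Qb] are the coefficients
    after the rotation. A suffix 0 marks the limit as [r] tends to 0. *)
Let V z (r : R) : C := f (r%:C%C * z) / r%:C%C.
Let Va z (r : R) : C := A (r%:C%C * z) * (z * h) + B (r%:C%C * z) * conjc (z * h).
Let Qa z r : C := L / 2 * V z r + L * Va z r.
Let Qb z r : C := - L / 2 * V z r + L * Va z r.
Let Nv z r : C := f (r%:C%C * (L * V z r)) / r%:C%C.
Let Na z r : C := A (r%:C%C * (L * V z r)) * Qa z r + B (r%:C%C * (L * V z r)) * conjc (Qb z r).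
Let Nb z r : C := A (r%:C%C * (L * V z r)) * Qb z r + B (r%:C%C * (L * V z r)) * conjc (Qa z r).

Let V0 z : C := rlin 1 m%:C%C z.
Let Va0 z : C := 1 * (z * h) + m%:C%C * conjc (z * h).
Let Qa0 z : C := L / 2 * V0 z + L * Va0 z.
Let Qb0 z : C := - L / 2 * V0 z + L * Va0 z.
Let Nv0 z : C := rlin 1 m%:C%C (L * V0 z).
Let Na0 z : C := 1 * Qa0 z + m%:C%C * conjc (Qb0 z).
Let Nb0 z : C := 1 * Qb0 z + m%:C%C * conjc (Qa0 z).

Let cvV z : cv0 (V z) (V0 z).
Proof. exact: cv0_blowup f0 sd0 (cv0_const z). Qed.

Let cvVa z : cv0 (Va z) (Va0 z).
Proof.
have cz := cv0_const z.
by apply: cv0D; apply: cv0M; [exact: cvA cz|exact: cv0_const|exact: cvB cz|exact: cv0_const].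
Qed.

Let cvLV z : cv0 (fun r => L * V z r) (L * V0 z).
Proof. by apply: cv0M; [exact: cv0_const|exact: cvV]. Qed.

Let cvQa z : cv0 (Qa z) (Qa0 z).
Proof.
by apply: cv0D; apply: cv0M; [exact: cv0_const|exact: cvV|exact: cv0_const|exact: cvVa].
Qed.

Let cvQb z : cv0 (Qb z) (Qb0 z).
Proof.
by apply: cv0D; apply: cv0M; [exact: cv0_const|exact: cvV|exact: cv0_const|exact: cvVa].
Qed.

Let cvNv z : cv0 (Nv z) (Nv0 z).
Proof. exact: cv0_blowup f0 sd0 (cvLV z). Qed.

Let cvNa z : cv0 (Na z) (Na0 z).
Proof.
apply: cv0D; apply: cv0M; [exact: cvA (cvLV z)|exact: cvQa|exact: cvB (cvLV z)|].
by apply: cv0J; exact: cvQb.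
Qed.

Let cvNb z : cv0 (Nb z) (Nb0 z).
Proof.
apply: cv0D; apply: cv0M; [exact: cvA (cvLV z)|exact: cvQb|exact: cvB (cvLV z)|].
by apply: cv0J; exact: cvQa.
Qed.

Let rV z r : 0 < r -> r%:C%C * (L * V z r) = L * f (r%:C%C * z).
Proof. by move=> r0; rewrite /V; have := cC r0 => rC; field. Qed.

Let sd_two_step z r : 0 < r ->
  sdiff (two_step z r) 0 (r%:C%C * Na z r) (r%:C%C * Nb z r).
Proof.
move=> r0; have rC := cC r0.
pose p c := r%:C%C * z * (1 + h * c + h * conjc c).
have p0 : p 0 = r%:C%C * z by rewrite /p conjc0; ring.
have sp : sdiff p 0 (r%:C%C * (z * h)) (r%:C%C * (z * h)).
  apply: sdiff_eq (sdiffM (sdiff_const (r%:C%C * z) 0) (sdiffD (sdiffD (sdiff_const 1 0)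
    (sdiffM (sdiff_const h 0) (sdiff_id 0))) (sdiffM (sdiff_const h 0) (sdiff_conj 0)))) _ _;
  by rewrite ?conjc0; ring.
have sv : sdiff (f \o p) 0 (r%:C%C * Va z r) (r%:C%C * Va z r).
  have H := fAB (p 0).
  by apply: sdiff_eq (sdiff_comp H sp) _ _; rewrite /Va p0 conjcZ; ring.
pose q c := L * (1 + c / 2 + - conjc c / 2) * f (p c).
have q0 : q 0 = r%:C%C * (L * V z r) by rewrite rV // /q p0 conjc0; ring.
have sq : sdiff q 0 (r%:C%C * Qa z r) (r%:C%C * Qb z r).
  have E : (f \o p) 0 = V z r * r%:C%C by rewrite /comp p0 divfK.
  have s1 : sdiff (fun c : C => L * (1 + c / 2 + - conjc c / 2)) 0 (L / 2) (- L / 2).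
    apply: sdiff_ext (_ : (fun c => L + L / 2 * c + (- L / 2) * conjc c) =1 _) _.
      by move=> c /=; ring.
    apply: sdiff_eq (sdiffD (sdiffD (sdiff_const L 0)
      (sdiffM (sdiff_const (L / 2) 0) (sdiff_id 0)))
      (sdiffM (sdiff_const (- L / 2) 0) (sdiff_conj 0))) _ _;
    by rewrite ?conjc0; ring.
  by apply: sdiff_eq (sdiffM s1 sv) _ _; rewrite E conjc0 /Qa /Qb; ring.
have H := fAB (q 0).
by apply: sdiff_eq (sdiff_comp H sq) _ _; rewrite /Na /Nb q0 !conjcZ; ring.
Qed.

(** Numerators in the quotient rule for [two_step z r / two_step 1 r] at 0, up to a power of [r];
    [jac] is the Jacobian determinant of this quotient up to a positive factor. *)
Let Xa z r := Na z r * Nv 1 r - Nv z r * Na 1 r.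
Let Xb z r := Nb z r * Nv 1 r - Nv z r * Nb 1 r.
Let Xa0 z := Na0 z * Nv0 1 - Nv0 z * Na0 1.
Let Xb0 z := Nb0 z * Nv0 1 - Nv0 z * Nb0 1.

Let jac z r := Xa z r * conjc (Xa z r) - Xb z r * conjc (Xb z r).

Let cv_jac z : cv0 (jac z) (Xa0 z * conjc (Xa0 z) - Xb0 z * conjc (Xb0 z)).
Proof.
have cXa : cv0 (Xa z) (Xa0 z).
  by apply: cv0D; [|apply: cv0N]; apply: cv0M.
have cXb : cv0 (Xb z) (Xb0 z).
  by apply: cv0D; [|apply: cv0N]; apply: cv0M.
by apply: cv0D; [|apply: cv0N]; apply: cv0M => //; apply: cv0J.
Qed.

Let jac_limit z :
  Xa0 z * conjc (Xa0 z) - Xb0 z * conjc (Xb0 z) =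
  - 4 * (z - conjc z) ^+ 2 * m%:C%C ^+ 2 * (L * conjc L) * (1 - m%:C%C ^+ 2) ^+ 2
    * h * (L ^+ 2 - conjc L ^+ 2).
Proof.
(* [P] and [Q] are the coefficients of the limiting map [w |-> w + m conj w], rotation by [L], and
   the same map again; [t] is the contribution of the second angle. *)
pose P := L + m%:C%C ^+ 2 * conjc L; pose Q := m%:C%C * (L + conjc L).
pose t x := (L * V0 x - m%:C%C * conjc L * (conjc x + m%:C%C * x)) / 2.
have mJ : conjc m%:C%C = m%:C%C :> C by exact: conjc_real.
have VJ x : conjc (V0 x) = conjc x + m%:C%C * x.
  by rewrite /V0 /rlin; conj_push; ring.
have hx x : conjc (x * h) = - (conjc x * h) by rewrite conjcM hJ; ring.
have VaJ x : conjc (Va0 x) = - (conjc x * h) + m%:C%C * (x * h).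
  by rewrite /Va0; conj_push; rewrite hJ; ring.
have NvE x : Nv0 x = P * x + Q * conjc x.
  by rewrite /Nv0 /rlin conjcM VJ /V0 /P /Q /rlin; ring.
have N2 : conjc (2^-1) = 2^-1 :> C by rewrite conjc_inv conjc_nat.
have NaE x : Na0 x = h * (P * x - Q * conjc x) + t x.
  rewrite /Na0 /Qb0 conjcD 3!conjcM conjcN N2 VJ VaJ /Qa0 /Va0 hx /t /P /Q /V0 /rlin; ring.
have NbE x : Nb0 x = h * (P * x - Q * conjc x) - t x.
  rewrite /Nb0 /Qa0 conjcD 3!conjcM N2 VJ VaJ /Qb0 /Va0 hx /t /P /Q /V0 /rlin; ring.
(* The two angles move the quotient in the directions [Xs] and [i Xt]. The Jacobian is [|Xs + Xt|^2
   - |Xs - Xt|^2 = 4 Re (Xs conj Xt)], which tests their independence over the reals. *)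
pose Xs := 2 * h * P * Q * (z - conjc z).
pose Xt := m%:C%C * (L * conjc L) * (1 - m%:C%C ^+ 2) * (z - conjc z).
have XaE : Xa0 z = Xs + Xt.
  rewrite /Xa0 !NaE !NvE /t /V0 /rlin !conjc1 /Xs /Xt /P /Q; field; rewrite ?pnatr_eq0 /=; exact: isT.
have XbE : Xb0 z = Xs - Xt.
  rewrite /Xb0 !NbE !NvE /t /V0 /rlin !conjc1 /Xs /Xt /P /Q; field; rewrite ?pnatr_eq0 /=; exact: isT.
have XsJ : conjc Xs = 2 * h * (conjc L + m%:C%C ^+ 2 * L) * Q * (z - conjc z).
  by rewrite /Xs /P /Q; conj_push; rewrite hJ; ring.
have XtJ : conjc Xt = - Xt by rewrite /Xt; conj_push; ring.
by rewrite XaE XbE conjcD conjcB XsJ XtJ /Xs /Xt /P /Q; ring.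
Qed.



Lemma nonconformal_interior z : complex.Im z != 0 -> interior_orb S z.
Proof.
move=> zi.
have zz : z - conjc z != 0.
  by case: z zi => x y /= yn; rewrite eq_complex /= opprK -mulr2n mulrn_eq0 (negPf yn) andbF.
have jn : Xa0 z * conjc (Xa0 z) - Xb0 z * conjc (Xb0 z) != 0.
  rewrite jac_limit.
  have m2 : 1 - m%:C%C ^+ 2 != 0 :> C.
    rewrite -rmorphXn -(rmorph1 (real_complex R)) -rmorphB -cmod_gt0 cmodR normr_gt0.
    by rewrite subr_eq0 eq_sym lt_eqF // expr_lt1 // ltW.
  have mC := cC m0.
  have L2 : L ^+ 2 - conjc L ^+ 2 != 0 by rewrite subr_eq0.
  by rewrite !mulf_neq0 ?expf_neq0 ?oppr_eq0 ?conjc_eq0 ?pnatr_eq0.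
have [r r0 jr] := cv0_neq0 (cv_jac z) jn.
have rC := cC r0.
pose N1 := two_step 1 r; pose Nz := two_step z r.
(* Neither perturbed factor vanishes on the unit disc, so the rotations are invertible there and the
   denominator [N1] is nonzero. *)
have T0 (a b c : C) : cmod a <= 1 / 2 -> cmod b <= 1 / 2 -> cmod c < 1 ->
    1 + a * c + b * conjc c != 0.
  move=> ha hb hc; apply/eqP => E.
  have : cmod (1 : C) <= cmod c.
    have -> : (1 : C) = - (a * c) - b * conjc c.
      by apply/eqP; rewrite -subr_eq0; apply/eqP; rewrite -[RHS]E; ring.
    apply: le_trans (cmodB _ _) _; rewrite cmodN !cmodM cmodJ -mulrDl.
    by rewrite -[leRHS]mul1r ler_wpM2r ?cmod_ge0 //; lra.
  by rewrite cmod1 leNgt hc.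
have half : cmod (2^-1 : C) = 1 / 2.
  by rewrite cmodV -[2 : C](rmorph_nat (real_complex R)) cmodR ger0_norm ?mul1r.
have Tt c : cmod c < 1 -> L * (1 + c / 2 + - conjc c / 2) != 0.
  move=> hc; rewrite mulf_neq0 // (_ : _ + _ = 1 + 2^-1 * c + - 2^-1 * conjc c); last by ring.
  by apply: T0; rewrite ?cmodN ?half.
have fn w : w != 0 -> f w != 0.
  by move=> w0; apply: contra w0 => /eqP fw; apply/eqP; apply: (planar_inj SG Sf); rewrite fw.
have N1c c : cmod c < 1 -> N1 c != 0.
  move=> hc; apply: (fn _); rewrite mulf_neq0 ?Tt //; apply: (fn _).
  by rewrite mulr1 mulf_neq0 // T0.
have N10 : N1 0 != 0 by apply: N1c; rewrite cmod0.
have s1 := sd_two_step 1 r0; have sz := sd_two_step z r0.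
have := sdiffM sz (sdiff_comp (sdiffV N10) s1); rewrite -/N1 -/Nz.
set a := (X in sdiff _ _ X); set b := (X in sdiff _ _ _ X) => sP.
have EN x : two_step x r 0 = r%:C%C * Nv x r.
  rewrite /Nv rV // mulrCA divff // mulr1 /two_step conjc0.
  have -> : 1 + h * 0 + h * 0 = 1 by ring.
  have -> : 1 + 0 / 2 + - 0 / 2 = 1 :> C by ring.
  by rewrite !mulr1.
have E1 : N1 0 = r%:C%C * Nv 1 r by exact: EN.
have Ez : Nz 0 = r%:C%C * Nv z r by exact: EN.
have Ea : a * N1 0 ^+ 2 = r%:C%C ^+ 2 * Xa z r.
  rewrite /a /Xa -/N1 /comp mul0r addr0.
  rewrite -[in RHS](_ : N1 0 / r%:C%C = Nv 1 r); last by rewrite E1; field.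
  rewrite -[in RHS](_ : Nz 0 / r%:C%C = Nv z r); last by rewrite Ez; field.
  by field; rewrite rC N10.
have Eb : b * N1 0 ^+ 2 = r%:C%C ^+ 2 * Xb z r.
  rewrite /b /Xb -/N1 /comp mul0r addr0.
  rewrite -[in RHS](_ : N1 0 / r%:C%C = Nv 1 r); last by rewrite E1; field.
  rewrite -[in RHS](_ : Nz 0 / r%:C%C = Nv z r); last by rewrite Ez; field.
  by field; rewrite rC N10.
apply: (interior_sdiff (r := 1) ltr01 _ sP).
  move=> c; rewrite subr0 => hc.
  (* For fixed [c] the quotient is the value given by [orb_ratio] for this [k], which fixes 0, and a
     second base point absorbing the first perturbation. *)
  pose k := f \o ((fun w => L * (1 + c / 2 + - conjc c / 2) * w + 0) \o f).
  have Sk : S k.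
    by apply: (planar_comp SG) => //; apply: (planar_comp SG) => //; apply: planar_affine => //; apply: Tt.
  have b0 : 0 != r%:C%C * (1 + h * c + h * conjc c).
    by rewrite eq_sym mulf_neq0 // T0.
  have := orb_ratio SG z Sk b0.
  have -> : k 0 = 0 by rewrite /k /= f0 mulr0 addr0 f0.
  rewrite !subr0 add0r /k /= !addr0.
  rewrite [z * _]mulrCA [z * _]mulrC => ?; rewrite /Nz /N1 /two_step mulr1.
  by rewrite -[_ * z * _]mulrA [z * _]mulrC.
apply: contra jr => /eqP ab.
have : cmod (Xa z r) = cmod (Xb z r).
  have K : cmod (a * N1 0 ^+ 2) = cmod (b * N1 0 ^+ 2) by rewrite !cmodM ab.
  move: K; rewrite Ea Eb 2![cmod (_ ^+ 2 * _)]cmodM => /mulfI; apply.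
  by rewrite cmod_eq0 expf_neq0.
by rewrite /jac -!cmod_sqrE => ->; rewrite subrr.
Qed.

(* Conjugating the dilates of [f] by [w => -1/w] turns three points of a line
   into three points of a circle through 0, whose images under
   [w + m conj w] are not concyclic with 0. *)
Lemma nonconformal_leaves_real (x : R) : generic x%:C%C ->
  exists2 z, complex.Im z != 0 & orb S x%:C%C z.
Proof.
move=> /andP[x0 x1].
pose I : C := 'i%C.
have IJ : conjc I = - I by rewrite /I; simpc.
have I2 : I ^+ 2 = -1 by exact: sqr_i.
(* Points of the line of real part 1, which [w |-> -1/w] sends to a circle through 0. The points
   [q 0], [q 1], [q x] and infinity have cross ratio [x]. *)
pose q (t : R) := 1 + I * t%:C%C.
have q0 t : q t != 0 by rewrite eq_complex /=; apply/nandP; left; apply/eqP; simpc => /=; lra.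
have qJ t : conjc (q t) = 1 - I * t%:C%C by rewrite /q; conj_push; rewrite IJ; ring.
have q'0 t : 1 - I * t%:C%C != 0 by rewrite -qJ conjc_eq0.
pose F t r := f (r%:C%C * - (q t)^-1) / r%:C%C.
pose l t := rlin 1 m%:C%C (- (q t)^-1).
have cF t : cv0 (F t) (l t) by exact: cv0_blowup f0 sd0 (cv0_const _).
pose n r := (F x r - F 0 r) * F 1 r; pose d r := (F 1 r - F 0 r) * F x r.
pose n0 := (l x - l 0) * l 1; pose d0 := (l 1 - l 0) * l x.
have cn : cv0 n n0.
  by apply: cv0M => //; apply: cv0D => //; apply: cv0N.
have cd : cv0 d d0.
  by apply: cv0M => //; apply: cv0D => //; apply: cv0N.
pose X : C := x%:C%C; pose M : C := m%:C%C.
(* [n r / d r] will be the new cross ratio. This expression vanishes whenever numerator and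
   denominator have a real ratio, and it needs no division. *)
have E : n0 * conjc d0 - conjc n0 * d0 = - 8 * I ^+ 3 * X * M * (1 - X) * (1 - M ^+ 2) * (1 + I ^+ 2 * X)
     / (((1 + I * X) * (1 - I * X)) ^+ 2 * ((1 + I) * (1 - I)) ^+ 2).
  have e1 := q0 1; have e2 := q'0 1; have e3 := q0 x; have e4 := q'0 x.
  rewrite /q mulr1 in e1; rewrite mulr1 in e2; rewrite -/X in e3 e4.
  rewrite /q -/X in e3.
  have lE t : l t = - (1 + I * t%:C%C)^-1 - M / (1 - I * t%:C%C).
    by rewrite /l /rlin conjcN conjc_inv qJ /q -/M; ring.
  have lJ t : conjc (l t) = - (1 - I * t%:C%C)^-1 - M / (1 + I * t%:C%C).
    by rewrite lE /M; conj_push; rewrite IJ mulNr opprK.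
  rewrite /n0 /d0 !conjcM !conjcB !lJ !lE !mulr0 !addr0 !subr0 !mulr1 -/X invr1.
  by field; rewrite e1 e2 e3 e4.
have nz : n0 * conjc d0 - conjc n0 * d0 != 0.
  rewrite E I2 mulN1r.
  have x1' : 1 - X != 0 by rewrite subr_eq0 eq_sym.
  have m2 : 1 - M ^+ 2 != 0 :> C.
    rewrite -rmorphXn -(rmorph1 (real_complex R)) -rmorphB -cmod_gt0 cmodR normr_gt0.
    by rewrite subr_eq0 eq_sym lt_eqF // expr_lt1 // ltW.
  have I0 : I != 0 by rewrite -sqrf_eq0 I2 oppr_eq0 oner_neq0.
  have mC := cC m0.
  have e1 := q0 1; have e2 := q'0 1; have e3 := q0 x; have e4 := q'0 x.
  rewrite /q mulr1 in e1; rewrite mulr1 in e2.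
  by rewrite !mulf_neq0 ?invr_eq0 ?expf_neq0 ?oppr_eq0 ?pnatr_eq0 ?mulf_neq0.
have [r r0 nr] : exists2 r : R, 0 < r & n r * conjc (d r) - conjc (n r) * d r != 0.
  apply: cv0_neq0 nz; apply: cv0D; [|apply: cv0N]; apply: cv0M => //; exact: cv0J.
have rC := cC r0.
have Sg : S (f \o (fun w => r%:C%C * w + 0)).
  by apply: (planar_comp SG) => //; apply: planar_affine.
(* The dilate of [f] by [r], conjugated by [w |-> -1/w]: its action on the line [q] is that of [f]
   on a circle of size [r] through 0. *)
have [k Sk kE] : exists2 k, S k & forall w, w != 0 -> k w = - (f (r%:C%C * - w^-1))^-1.
  have g0 : (f \o (fun w => r%:C%C * w + 0)) 0 = 0 by rewrite /= mulr0 addr0.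
  have [k Sk kE] := planar_conj_inv SG Sg g0.
  by exists k => // w /kE ->; rewrite /= addr0.
have q01 : q 0 != q 1.
  by rewrite /q mulr0 addr0 mulr1 eq_sym -subr_eq0 addrAC subrr add0r -sqrf_eq0 I2 oppr_eq0 oner_neq0.
exists (n r / d r); last first.
  have := orb_ratio SG x%:C%C Sk q01.
  have -> : q 0 + x%:C%C * (q 1 - q 0) = q x.
    by rewrite /q rmorph0 rmorph1; ring.
  rewrite !kE // -/(F _ _).
  have FE t : f (r%:C%C * - (q t)^-1) = r%:C%C * F t r by rewrite /F; field.
  have Fn t : F t r != 0.
    rewrite /F mulf_neq0 ?invr_eq0 //; apply/eqP => e.
    have : r%:C%C * - (q t)^-1 = 0 by apply: (planar_inj SG Sf); rewrite e.
    by apply/eqP; rewrite mulf_neq0 // oppr_eq0 invr_eq0.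
  rewrite !FE; congr (orb S _ _); rewrite /n /d.
  have F01 : F 1 r - F 0 r != 0.
    rewrite subr_eq0; apply: contra q01 => /eqP e.
    have /(planar_inj SG Sf) : f (r%:C%C * - (q 1)^-1) = f (r%:C%C * - (q 0)^-1).
      by rewrite !FE e.
    by move=> /(mulfI rC) /oppr_inj /invr_inj ->.
  by field; rewrite F01 !Fn rC.
apply: contra nr => /eqP Im0.
have dn : conjc (n r / d r) = n r / d r.
  by case: (n r / d r) Im0 => u v /= ->; rewrite oppr0.
have [d00|d00] := eqVneq (d r) 0; first by rewrite d00 conjc0 !mulr0 subrr.
have -> : conjc (n r) = n r / d r * conjc (d r) by rewrite -dn -conjcM divfK.
by apply/eqP; field.
Qed.

End Nonconformal.

(** * Transitivity on cross ratios *)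

Section Transitivity.
Variable R : realType.
Local Notation C := R[i].

Lemma planar_interior (S : set (C -> C)) f : planar_group S -> S f ->
  (forall a b, exists w, f w <> a * w + b) ->
  forall z, generic z -> interior_orb S z.
Proof.
move=> SG Sf naff z gz.
have /choice[AB HAB] w : exists p : C * C, sdiff f w p.1 p.2 /\ cmod p.2 < cmod p.1.
  by have [a [b ab]] := planar_sdiff SG Sf w; exists (a, b).
have [Bz|] := EM (forall w, (AB w).2 = 0).
  have hf w : hol f w by exists (AB w).1; rewrite -(Bz w); have [] := HAB w.
  have [//|H] := conformal_interior SG z Sf hf.
  have [a [b fE]] := ratio_preserving_affine gz hf H.
  by have [w []] := naff a b.
move=> /existsNP[w0 /eqP Bw0].
have [sw ba] := HAB w0.
set a := (AB w0).1 in sw ba; set b := (AB w0).2 in sw ba Bw0.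
have a0 : a != 0 by rewrite -cmod_gt0; apply: le_lt_trans ba; apply: cmod_ge0.
(* The dilation by [c] makes the Beltrami coefficient [b/a] a positive real. *)
pose c := sqrtc (b / a).
have c2 : c ^+ 2 = b / a by exact: sqr_sqrtc.
have c0 : c != 0 by rewrite sqrtc_eq0 mulf_neq0 ?invr_eq0.
pose m := cmod c ^+ 2.
have m0 : 0 < m by rewrite exprn_gt0 // cmod_gt0.
have m1 : m < 1.
  by rewrite /m expr2 -cmodM -expr2 c2 cmodM cmodV ltr_pdivrMr ?mul1r // cmod_gt0.
(* Affine maps on both sides move [w0] and [f w0] to 0 and bring the derivative to [w + m conj w],
   because [b conj c / (a c) = c conj c]. *)
pose g x := (a * c)^-1 * f (c * x + w0) + - f w0 / (a * c).
have ac : a * c != 0 by rewrite mulf_neq0.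
have Sg : S g.
  apply: (planar_comp SG (f := fun x => (a * c)^-1 * x + - f w0 / (a * c)) (g := f \o (fun x => c * x + w0))).
    by apply: planar_affine; rewrite ?invr_eq0.
  by apply: planar_comp => //; apply: planar_affine.
have g0 : g 0 = 0 by rewrite /g mulr0 add0r; ring.
pose A x := (AB (c * x + w0)).1 / a; pose B x := (AB (c * x + w0)).2 * conjc c / (a * c).
have gAB x : sdiff g x (A x) (B x).
  have [sx _] := HAB (c * x + w0).
  have sg : sdiff (fun x => c * x + w0) x c 0.
    apply: sdiff_eq (sdiffD (sdiffM (sdiff_const c x) (sdiff_id x)) (sdiff_const w0 x)) _ _; ring.
  have H := sdiffD (sdiffM (sdiff_const (a * c)^-1 x) (sdiff_comp (g := fun x => c * x + w0) sx sg))
     (sdiff_const (- f w0 / (a * c)) x).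
  by apply: sdiff_eq H _ _; rewrite /A /B; conj_push; field; rewrite a0 c0.
have A0 : A 0 = 1 by rewrite /A mulr0 add0r divff.
have B0 : B 0 = m%:C%C.
  rewrite /B mulr0 add0r /m cmod_sqrE -/b.
  have -> : b = c ^+ 2 * a by rewrite c2 divfK.
  by field; rewrite a0 c0.
(* With [h = i/2] the first factor is [1 + i Re c]; with [L = 1 + i] the square [L^2 = 2i] is not
   real. *)
pose h : C := Complex 0 (1 / 2); pose L : C := Complex 1 1.
have nonreal v : complex.Im v != 0 -> interior_orb S v.
  apply: (nonconformal_interior SG Sg g0 gAB A0 B0 m0 m1 (L := L) (h := h)).
  - by rewrite /h; simpc.
  - by rewrite /h eq_complex /= negb_and; apply/orP; right; apply/eqP; lra.
  - by rewrite /cmod /h /= expr0n add0r sqrtr_sqr ger0_norm //; lra.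
  - by rewrite /L eq_complex /= oner_eq0.
  - rewrite /L !expr2; simpc; rewrite eq_complex /= negb_and; apply/orP; right; apply/eqP; lra.
have [zr|] := eqVneq (complex.Im z) 0; last exact: nonreal.
have zE : z = (complex.Re z)%:C%C by case: z zr {gz} => x y /= ->.
rewrite zE in gz *.
have [v vi zv] := nonconformal_leaves_real SG Sg g0 gAB A0 B0 m0 m1 gz.
by apply: interior_orb_trans zv (nonreal v vi).
Qed.

Theorem planar_transitive (S : set (C -> C)) f : planar_group S -> S f ->
  (forall a b, exists w, f w <> a * w + b) ->
  forall z w, generic z -> generic w -> exists h, [/\ S h, h 0 = 0, h 1 = 1 & h z = w].
Proof.
move=> SG Sf naff z w gz gw.
by apply: (orb_all SG _ gz gw); apply: planar_interior naff.
Qed.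

End Transitivity.

(** * The chart given by stereographic projection *)

Section StrictC1.
Variable R : realType.

Lemma rV_nbhs n (x : 'rV[R]_n) (P : set 'rV[R]_n) : nbhs x P ->
  exists2 d : R, 0 < d & forall y : 'rV[R]_n, (forall k, `|y ord0 k - x ord0 k| < d) -> P y.
Proof.
move=> /nbhs_ballP[d /= d0 Hd]; exists d => // y yx; apply: Hd.
rewrite -ball_normE /= /Num.Def.normr /= mx_normrE.
apply: bigmax_lt => // -[i j] _ /=; rewrite !mxE (ord1 i) distrC; exact: yx.
Qed.

Lemma rV_norm_coord n (x : 'rV[R]_n) k : `|x ord0 k| <= `|x|.
Proof.
rewrite [leRHS]/Num.Def.normr /= mx_normrE.
exact: (le_bigmax _ (fun ij : 'I_1 * 'I_n => `|x ij.1 ij.2|) (ord0, k)).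
Qed.

(** The two conditions on [t] say that it lies between [a] and [b], whatever their order. *)
Lemma mvt_bound (f df : R -> R) (c e a b : R) :
  (forall t, `|t - b| <= `|a - b| -> `|t - a| <= `|a - b| ->
     is_derive t 1 f (df t) /\ `|df t - c| <= e) ->
  `|f a - f b - (a - b) * c| <= e * `|a - b|.
Proof.
have main (u v : R) : u <= v -> (forall t, u <= t <= v ->
     is_derive t 1 f (df t) /\ `|df t - c| <= e) ->
     `|f v - f u - (v - u) * c| <= e * (v - u).
  move=> uv H.
  have [| |t tuv ->] := MVT_segment (f := f) (df := df) uv.
  - by move=> t; rewrite in_itv /= => /andP[h1 h2]; have [] := H t; rewrite // !ltW.
  - apply: derivable_within_continuous => t; rewrite in_itv /= => /H[h _].
    exact: ex_derive.
  rewrite [_ * c]mulrC -mulrBl normrM (ger0_norm (_ : 0 <= v - u)) ?subr_ge0 //.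
  rewrite ler_wpM2r ?subr_ge0 //.
  by move: tuv; rewrite in_itv /= => /H[].
move=> H; have [ab|ba] := leP a b.
  rewrite distrC (_ : `|a - b| = b - a); last by rewrite distrC ger0_norm ?subr_ge0.
  have -> : (a - b) * c - (f a - f b) = f b - f a - (b - a) * c by ring.
  apply: main => // t /andP[ta tb]; apply: H.
    by rewrite distrC [leRHS]distrC !ger0_norm ?subr_ge0 // lerD2l lerN2.
  by rewrite [leRHS]distrC !ger0_norm ?subr_ge0 // lerD2r.
rewrite (_ : `|a - b| = a - b); last by rewrite ger0_norm // subr_ge0 ltW.
apply: main; first exact: ltW.
move=> t /andP[tb ta]; apply: H; rewrite [leRHS]ger0_norm ?subr_ge0 ?(ltW ba) //.
  by rewrite ger0_norm ?subr_ge0 // lerD2r.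
by rewrite distrC ger0_norm ?subr_ge0 // lerD2l lerN2.
Qed.

Lemma is_derive_axis n (G : 'rV[R]_n -> R) (p v : 'rV[R]_n) (s : R) :
  derivable G (p + s *: v) v ->
  is_derive s 1 (fun t : R => G (p + t *: v)) ('D_v G (p + s *: v)).
Proof.
move=> H.
have E : (fun h : R => h^-1 *: (((fun t : R => G (p + t *: v)) \o shift s) (h *: 1) - G (p + s *: v)))
  = (fun h : R => h^-1 *: ((G \o shift (p + s *: v)) (h *: v) - G (p + s *: v))).
  apply/funext => h /=; congr (_ *: (G _ - _)).
  by rewrite scalerDl /GRing.scale /= mulr1 addrCA.
by split; rewrite /derivable /derive E.
Qed.

Variables (n : nat) (U : set 'rV[R]_n) (F : 'rV[R]_n -> 'rV[R]_n) (x : 'rV[R]_n).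
Hypothesis (Uo : open U) (Ux : U x).
Hypothesis F1 : forall y, U y -> forall v : 'rV[R]_n,
  derivable F y v /\ {for y, continuous (fun y => 'D_v F y)}.

Let E k : 'rV[R]_n := delta_mx ord0 k.

(* Move one coordinate at a time and apply the mean value theorem. *)
Lemma C1_strict (i : 'I_n) (e : R) : 0 < e -> exists2 d : R, 0 < d &
  forall y y' : 'rV[R]_n, (forall k, `|y ord0 k - x ord0 k| < d) ->
    (forall k, `|y' ord0 k - x ord0 k| < d) ->
    `|F y ord0 i - F y' ord0 i - \sum_k (y ord0 k - y' ord0 k) * ('D_(E k) F x) ord0 i|
      <= e * \sum_k `|y ord0 k - y' ord0 k|.
Proof.
move=> e0.
have nb : \forall y \near x, U y /\ forall k : 'I_n,
    `|('D_(E k) F y - 'D_(E k) F x) ord0 i| <= e.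
  apply: filterI; first exact: open_nbhs_nbhs.
  apply: (filter_forall (nbhs_filter x)) => k.
  have [_ /(_ _)] := F1 Ux (E k) => /cvgrPdist_le /(_ _ e0).
  apply: filterS => y h; apply: le_trans h; rewrite distrC.
  exact: rV_norm_coord.
have [d d0 Hd] := rV_nbhs nb; exists d => // y y' hy hy'.
pose w (j : nat) : 'rV[R]_n := \row_k (if (k < j)%N then y ord0 k else y' ord0 k).
have w0 : w 0 = y' by apply/rowP => k; rewrite mxE.
have wn : w n = y by apply/rowP => k; rewrite mxE ltn_ord.
have tele : F y ord0 i - F y' ord0 i = \sum_(k < n) (F (w k.+1) ord0 i - F (w k) ord0 i).
  rewrite -{1}wn -{1}w0 -(telescope_sumr (fun j => F (w j) ord0 i)) // big_mkord.
  by [].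
rewrite tele -sumrB mulr_sumr; apply: le_trans (ler_norm_sum _ _ _) _.
apply: ler_sum => k _.
(* [p] is [w k] with its [k]-th coordinate set to 0, so that [t] in [p + t E k] is that coordinate
   itself. *)
pose p : 'rV[R]_n := w k - (y' ord0 k) *: E k.
pose phi (t : R) := F (p + t *: E k) ord0 i.
have pk : p + y' ord0 k *: E k = w k by rewrite subrK.
have pk1 : p + y ord0 k *: E k = w k.+1.
  apply/rowP => j; rewrite !mxE eqxx /=.
  have [->|jk] := eqVneq j k; first by rewrite ltnn ltnSn /=; ring.
  by rewrite [(j < k.+1)%N]ltnS [(j <= k)%N]leq_eqVlt (negPf (_ : (j : nat) != k)) //=; ring.
rewrite -pk -pk1 -/(phi _) -/(phi _).
apply: (mvt_bound (df := fun t => ('D_(E k) F (p + t *: E k)) ord0 i)) => t tb ta.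
have [Ut Dt] : U (p + t *: E k) /\ forall k', `|('D_(E k') F (p + t *: E k) - 'D_(E k') F x) ord0 i| <= e.
  apply: Hd => j; rewrite !mxE eqxx /=.
  have [->|jk] := eqVneq j k; last first.
    by rewrite !mulr0 subr0 addr0; case: ifP => _; [apply: hy | apply: hy'].
  rewrite ltnn /= (_ : _ - x ord0 k = t - x ord0 k); last by ring.
  have h1 := hy k; have h2 := hy' k.
  move: tb ta h1 h2; rewrite !ler_norml !ltr_norml.
  case: (leP (y ord0 k) (y' ord0 k)) => yy; [rewrite ler0_norm ?subr_le0 //|rewrite gtr0_norm ?subr_gt0 //];
  lra.
have [Dv _] := F1 Ut (E k).
split; last by have := Dt k; rewrite !mxE.
have -> : ('D_(E k) F (p + t *: E k)) ord0 i = 'D_(E k) (fun z => F z ord0 i) (p + t *: E k).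
  by rewrite derive_mx // mxE.
apply: (is_derive_axis (G := fun z => F z ord0 i)).
by have /derivable_mxP := Dv; apply.
Qed.

End StrictC1.

(** * Coordinates and distances on the sphere *)

Section Coordinates.
Variable R : realType.
Local Notation C := R[i].
Implicit Types (u v : vec R) (w z : C).

Lemma sum3 (V : nmodType) (f : 'I_3 -> V) :
  \sum_k f k = f (inord 0) + f (inord 1) + f (inord 2).
Proof.
rewrite !big_ord_recl big_ord0 addr0 addrA.
by congr (f _ + f _ + f _); apply/val_inj; rewrite /= inordK.
Qed.

Lemma forall3 (P : 'I_3 -> Prop) : P (inord 0) -> P (inord 1) -> P (inord 2) ->
  forall k, P k.
Proof.
move=> h0 h1 h2 [[|[|[|//]]] hk].
- by rewrite (_ : Ordinal hk = inord 0) //; apply/val_inj; rewrite /= inordK.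
- by rewrite (_ : Ordinal hk = inord 1) //; apply/val_inj; rewrite /= inordK.
- by rewrite (_ : Ordinal hk = inord 2) //; apply/val_inj; rewrite /= inordK.
Qed.

Lemma cx_mkv (x y z : R) : cx (mkv x y z) = x.
Proof. by rewrite /cx mxE inordK. Qed.
Lemma cy_mkv (x y z : R) : cy (mkv x y z) = y.
Proof. by rewrite /cy mxE inordK. Qed.
Lemma cz_mkv (x y z : R) : cz (mkv x y z) = z.
Proof. by rewrite /cz mxE inordK. Qed.
Definition c_mkv := (cx_mkv, cy_mkv, cz_mkv).

Lemma dotvE u v : dotv u v = cx u * cx v + cy u * cy v + cz u * cz v.
Proof. by rewrite /dotv sum3. Qed.

Lemma cxB u v : cx (u - v) = cx u - cx v. Proof. by rewrite /cx !mxE. Qed.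
Lemma cyB u v : cy (u - v) = cy u - cy v. Proof. by rewrite /cy !mxE. Qed.
Lemma czB u v : cz (u - v) = cz u - cz v. Proof. by rewrite /cz !mxE. Qed.

Lemma vec_eq u v : cx u = cx v -> cy u = cy v -> cz u = cz v -> u = v.
Proof. by move=> hx hy hz; apply/rowP; apply: forall3. Qed.

Lemma sdistE u v : Defs.edist u v =
  Num.sqrt ((cx u - cx v) ^+ 2 + (cy u - cy v) ^+ 2 + (cz u - cz v) ^+ 2).
Proof. by rewrite /Defs.edist dotvE !(cxB, cyB, czB) -!expr2. Qed.

Lemma sdist_refl u : Defs.edist u u = 0.
Proof. by rewrite sdistE !subrr expr0n !addr0 sqrtr0. Qed.

Lemma den_gt0 (x y : R) : 0 < x ^+ 2 + y ^+ 2 + 1.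
Proof. by rewrite ltr_wpDl // addr_ge0 // sqr_ge0. Qed.

Lemma den_neq0 (x y : R) : x ^+ 2 + y ^+ 2 + 1 != 0.
Proof. by rewrite gt_eqF // den_gt0. Qed.

Lemma stereo_invE (x y : R) : stereo_inv (Complex x y) =
  mkv (2 * x / (x ^+ 2 + y ^+ 2 + 1)) (2 * y / (x ^+ 2 + y ^+ 2 + 1))
      ((x ^+ 2 + y ^+ 2 - 1) / (x ^+ 2 + y ^+ 2 + 1)).
Proof. by []. Qed.

Lemma stereo_inv_sph w : dotv (stereo_inv w) (stereo_inv w) == 1.
Proof.
case: w => x y; rewrite stereo_invE dotvE !c_mkv; apply/eqP; have := den_neq0 x y.
by move=> d; field.
Qed.

Lemma North_sph : dotv (North R) (North R) == 1.
Proof. by rewrite dotvE !c_mkv; apply/eqP; ring. Qed.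

Definition pt w : sph R := exist _ (stereo_inv w) (stereo_inv_sph w).
Definition npole : sph R := exist _ (North R) North_sph.

Lemma val_pt w : val (pt w) = stereo_inv w. Proof. by []. Qed.
Lemma val_npole : val npole = North R. Proof. by []. Qed.

Lemma stereo_invK : cancel (@stereo_inv R) (@stereo R).
Proof.
case=> x y; rewrite stereo_invE /stereo !c_mkv; have d := den_neq0 x y.
set D := _ + 1 in d *.
have -> : 1 - (x ^+ 2 + y ^+ 2 - 1) / D = 2 / D by rewrite /D in d *; field.
have D2 : Complex (2 / D) 0 != 0.
  by rewrite eq_complex /= eqxx andbT mulf_neq0 ?invr_eq0.
apply: (mulIf D2); rewrite divfK //; simpc.
by congr Complex; ring.
Qed.

Lemma stereo_inv_North w : stereo_inv w != North R.
Proof.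
case: w => x y; rewrite stereo_invE; apply/eqP => /(congr1 (@cz R)).
rewrite !c_mkv; have d := den_neq0 x y.
move=> /(congr1 (fun t => t * (x ^+ 2 + y ^+ 2 + 1))); rewrite divfK //.
lra.
Qed.

Lemma pt_inj : injective pt.
Proof. by move=> z w /(congr1 val); apply: can_inj stereo_invK _ _. Qed.

Lemma pt_npole w : pt w <> npole.
Proof. by move=> /(congr1 val) /eqP; rewrite (negPf (stereo_inv_North w)). Qed.

Lemma sph_cases (p : sph R) : p = npole \/ exists w, p = pt w.
Proof.
have hp : cx (val p) ^+ 2 + cy (val p) ^+ 2 + cz (val p) ^+ 2 = 1.
  by have /eqP := valP p; rewrite dotvE !expr2.
have [z1|z1] := eqVneq (cz (val p)) 1.
  left; apply/val_inj; rewrite val_npole.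
  have : cx (val p) ^+ 2 + cy (val p) ^+ 2 == 0 by apply/eqP; move: hp; rewrite z1; lra.
  rewrite paddr_eq0 ?sqr_ge0 // !sqrf_eq0 => /andP[/eqP x0 /eqP y0].
  by apply: vec_eq; rewrite !c_mkv.
right; have d : 1 - cz (val p) != 0 by rewrite subr_eq0 eq_sym.
exists (Complex (cx (val p) / (1 - cz (val p))) (cy (val p) / (1 - cz (val p)))).
apply/val_inj; rewrite val_pt stereo_invE.
set x := cx (val p) in hp *; set y := cy (val p) in hp *; set z := cz (val p) in hp z1 d *.
have E : (x / (1 - z)) ^+ 2 + (y / (1 - z)) ^+ 2 = (1 + z) / (1 - z).
  rewrite !expr_div_n -mulrDl (_ : x ^+ 2 + y ^+ 2 = (1 - z) * (1 + z)).
    by field.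
  by rewrite (_ : x ^+ 2 + y ^+ 2 = 1 - z ^+ 2); [ring | move: hp; lra].
have E1 : (1 + z) / (1 - z) + 1 = 2 / (1 - z) by field.
have E2 : (1 + z) / (1 - z) - 1 = 2 * z / (1 - z) by field.
by apply: vec_eq; rewrite !c_mkv E ?E1 ?E2 -/x -/y -/z; field.
Qed.

(** The squared chordal distance is [4 |z - w|^2 / ((|z|^2 + 1) (|w|^2 + 1))]. *)
Lemma sdist_pt z w : Defs.edist (val (pt z)) (val (pt w)) <= 2 * cmod (z - w).
Proof.
case: z => x y; case: w => x' y'; rewrite !val_pt !stereo_invE sdistE !c_mkv.
have d := den_neq0 x y; have d' := den_neq0 x' y'.
rewrite [X in Num.sqrt X](_ : _ = 4 * ((x - x') ^+ 2 + (y - y') ^+ 2) /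
   ((x ^+ 2 + y ^+ 2 + 1) * (x' ^+ 2 + y' ^+ 2 + 1))); last by field; rewrite d d'.
have B0 : 0 <= (x - x') ^+ 2 + (y - y') ^+ 2 by rewrite addr_ge0 ?sqr_ge0.
rewrite -ler_sqr ?nnegrE ?mulr_ge0 ?sqrtr_ge0 // exprMn !sqr_sqrtr //; last first.
  by rewrite divr_ge0 ?mulr_ge0 // ltW // den_gt0.
rewrite ler_pdivrMr ?mulr_gt0 ?den_gt0 //= -[X in X <= _]mulr1 (_ : 2 ^+ 2 = 4); last by ring.
rewrite ler_wpM2l ?mulr_ge0 //; apply: mulr_ege1.
  by rewrite lerDr addr_ge0 ?sqr_ge0.
by rewrite lerDr addr_ge0 ?sqr_ge0.
Qed.

Lemma sdist_triangle_max u v : Defs.edist u v <=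
  `|cx u - cx v| + `|cy u - cy v| + `|cz u - cz v|.
Proof.
rewrite sdistE -ler_sqr ?nnegrE ?sqrtr_ge0 ?addr_ge0 // sqr_sqrtr ?addr_ge0 ?sqr_ge0 //.
have := normr_ge0 (cx u - cx v); have := normr_ge0 (cy u - cy v).
have := normr_ge0 (cz u - cz v).
rewrite -(real_normK (num_real (cx u - cx v))) -(real_normK (num_real (cy u - cy v))).
rewrite -(real_normK (num_real (cz u - cz v))); nra.
Qed.

Lemma sdist_coord u v k : `|u ord0 k - v ord0 k| <= Defs.edist u v.
Proof.
rewrite -sqrtr_sqr sdistE; apply: ler_wsqrtr; move: k.
have h := (sqr_ge0 (cx u - cx v), sqr_ge0 (cy u - cy v), sqr_ge0 (cz u - cz v)).
move: h => [[hx hy] hz].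
by apply: forall3; rewrite -/(cx _) -/(cx v) -/(cy _) -/(cy v) -/(cz _) -/(cz v); lra.
Qed.

Lemma sdist_triangle v u (x : vec R) : Defs.edist u x <= Defs.edist u v + Defs.edist v x.
Proof.
rewrite !sdistE.
set a1 := cx u - cx v; set a2 := cy u - cy v; set a3 := cz u - cz v.
set b1 := cx v - cx x; set b2 := cy v - cy x; set b3 := cz v - cz x.
have -> : cx u - cx x = a1 + b1 by rewrite /a1 /b1; ring.
have -> : cy u - cy x = a2 + b2 by rewrite /a2 /b2; ring.
have -> : cz u - cz x = a3 + b3 by rewrite /a3 /b3; ring.
have A0 : 0 <= a1 ^+ 2 + a2 ^+ 2 + a3 ^+ 2 by rewrite !addr_ge0 ?sqr_ge0.
have B0 : 0 <= b1 ^+ 2 + b2 ^+ 2 + b3 ^+ 2 by rewrite !addr_ge0 ?sqr_ge0.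
rewrite -ler_sqr ?nnegrE ?addr_ge0 ?sqrtr_ge0 // sqr_sqrtr ?addr_ge0 ?sqr_ge0 //.
rewrite [leRHS]sqrrD (sqr_sqrtr A0) (sqr_sqrtr B0).
have CS : a1 * b1 + a2 * b2 + a3 * b3 <=
   Num.sqrt (a1 ^+ 2 + a2 ^+ 2 + a3 ^+ 2) * Num.sqrt (b1 ^+ 2 + b2 ^+ 2 + b3 ^+ 2).
  rewrite -sqrtrM //; apply: le_trans (ler_norm _) _; rewrite -sqrtr_sqr; apply: ler_wsqrtr.
  (* Lagrange's identity, giving Cauchy-Schwarz. *)
  rewrite -subr_ge0 (_ : _ - _ = (a1 * b2 - a2 * b1) ^+ 2 + (a1 * b3 - a3 * b1) ^+ 2
    + (a2 * b3 - a3 * b2) ^+ 2); last by ring.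
  by rewrite !addr_ge0 ?sqr_ge0.
move: CS; lra.
Qed.

End Coordinates.

(** * Inverse stereographic projection and its differential *)

Section Chart.
Variable R : realType.
Local Notation C := R[i].
Implicit Types (w z xi : C).

Let J : C := 'i%C.
Let den w : C := w * conjc w + 1.

Let denE (x y : R) : den (Complex x y) = (x ^+ 2 + y ^+ 2 + 1)%:C%C.
Proof. by rewrite /den; simpc; congr Complex; ring. Qed.

Let den0 w : den w != 0.
Proof. by case: w => x y; rewrite denE -cmod_gt0 cmodR normr_gt0 den_neq0. Qed.

Let JJ : conjc J = - J. Proof. by rewrite /J; simpc. Qed.

(** Coordinates are taken as complex numbers so that the calculus of [sdiff] applies to them. *)
Definition chart (k : 'I_3) w : C := (stereo_inv w ord0 k)%:C%C.

Lemma chart0E w : chart (inord 0) w = (w + conjc w) / den w.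
Proof.
case: w => x y; rewrite denE /chart -/(cx _) stereo_invE cx_mkv.
by rewrite rmorphM fmorphV; congr (_ * _); simpc; congr Complex; ring.
Qed.

Lemma chart1E w : chart (inord 1) w = - J * (w - conjc w) / den w.
Proof.
case: w => x y; rewrite denE /chart -/(cy _) stereo_invE cy_mkv.
by rewrite rmorphM fmorphV; congr (_ * _); rewrite /J; simpc; congr Complex; ring.
Qed.

Lemma chart2E w : chart (inord 2) w = 1 - 2 / den w.
Proof.
case: w => x y; rewrite denE /chart -/(cz _) stereo_invE cz_mkv.
have d := den_neq0 x y.
rewrite (_ : _ / _ = 1 - 2 / (x ^+ 2 + y ^+ 2 + 1)); last by field.
by rewrite rmorphB rmorph1 rmorphM fmorphV rmorph_nat.
Qed.

(* [chart k] is real valued, so its derivative has the form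
   [rlin (dchart k w) (conjc (dchart k w))]. *)
Definition dchart (k : 'I_3) w : C :=
  nth 0 [:: (den w)^-1 - (w + conjc w) * conjc w / den w ^+ 2;
            - J / den w + J * (w - conjc w) * conjc w / den w ^+ 2;
            2 * conjc w / den w ^+ 2] k.

Let dchart0 w : dchart (inord 0) w = (den w)^-1 - (w + conjc w) * conjc w / den w ^+ 2.
Proof. by rewrite /dchart inordK. Qed.
Let dchart1 w : dchart (inord 1) w = - J / den w + J * (w - conjc w) * conjc w / den w ^+ 2.
Proof. by rewrite /dchart inordK. Qed.
Let dchart2 w : dchart (inord 2) w = 2 * conjc w / den w ^+ 2.
Proof. by rewrite /dchart inordK. Qed.

Let denJ w : conjc (den w) = den w.
Proof. by rewrite /den; conj_push; ring. Qed.

Ltac den_push := rewrite ?(denJ, JJ, conjcD, conjcB, conjcN, conjcM, conjcX,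
  conjc_inv, conjcK, conjc1, conjc_nat).

Lemma sdiff_chart k w : sdiff (chart k) w (dchart k w) (conjc (dchart k w)).
Proof.
have d0 := den0 w.
have sI := sdiff_id w; have sJ := sdiff_conj w.
have sd : sdiff den w (conjc w) w.
  by apply: sdiff_eq (sdiffD (sdiffM sI sJ) (sdiff_const 1 w)) _ _; rewrite /=; ring.
have sV : sdiff (fun w => (den w)^-1) w (- conjc w / den w ^+ 2) (- w / den w ^+ 2).
  by apply: sdiff_eq (sdiff_comp (f := fun x => x^-1) (sdiffV d0) sd) _ _; ring.
move: k; apply: forall3.
- apply: sdiff_ext (_ : (fun w => (w + conjc w) / den w) =1 _) _.
    by move=> v; rewrite chart0E.
  apply: sdiff_eq (sdiffM (sdiffD sI sJ) sV) _ _; rewrite dchart0; first by ring.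
  by den_push; ring.
- apply: sdiff_ext (_ : (fun w => (- J * (w + - 1 * conjc w)) / den w) =1 _) _.
    by move=> v; rewrite chart1E; congr (_ * _ / _); ring.
  apply: sdiff_eq (sdiffM (sdiffM (sdiff_const (- J) w)
    (sdiffD sI (sdiffM (sdiff_const (-1) w) sJ))) sV) _ _; rewrite dchart1; first by ring.
  by den_push; ring.
- apply: sdiff_ext (_ : (fun w => 1 + - 2 * (den w)^-1) =1 _) _.
    by move=> v; rewrite chart2E; ring.
  apply: sdiff_eq (sdiffD (sdiff_const 1 w) (sdiffM (sdiff_const (-2) w) sV)) _ _;
  rewrite dchart2; first by ring.
  by den_push; ring.
Qed.

(* The differential of [stereo_inv] at [w]. *)
Definition tangent w xi : vec R :=
  \row_k complex.Re (rlin (dchart k w) (conjc (dchart k w)) xi).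

Lemma tangentE w xi k :
  (tangent w xi ord0 k)%:C%C = rlin (dchart k w) (conjc (dchart k w)) xi.
Proof.
rewrite mxE; set r := rlin _ _ _.
have rJ : conjc r = r by rewrite /r /rlin; conj_push; ring.
by case: r rJ => x y [] /= h; congr Complex; lra.
Qed.

Let tangent0 w xi : (cx (tangent w xi))%:C%C =
  (xi + conjc xi) / den w - (w + conjc w) * (conjc w * xi + w * conjc xi) / den w ^+ 2.
Proof. by rewrite /cx tangentE dchart0 /rlin; den_push; ring. Qed.

Let tangent1 w xi : (cy (tangent w xi))%:C%C =
  - J * ((xi - conjc xi) / den w - (w - conjc w) * (conjc w * xi + w * conjc xi) / den w ^+ 2).
Proof. by rewrite /cy tangentE dchart1 /rlin; den_push; ring. Qed.

Let tangent2 w xi : (cz (tangent w xi))%:C%C =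
  2 * (conjc w * xi + w * conjc xi) / den w ^+ 2.
Proof. by rewrite /cz tangentE dchart2 /rlin; den_push; ring. Qed.

Let sinv0 w : (cx (stereo_inv w))%:C%C = (w + conjc w) / den w.
Proof. exact: chart0E. Qed.
Let sinv1 w : (cy (stereo_inv w))%:C%C = - J * (w - conjc w) / den w.
Proof. exact: chart1E. Qed.
Let sinv2 w : (cz (stereo_inv w))%:C%C = 1 - 2 / den w.
Proof. exact: chart2E. Qed.

Lemma tangent_orth w xi : dotv (tangent w xi) (stereo_inv w) = 0.
Proof.
apply: (@complexI R); rewrite dotvE.
transitivity ((cx (tangent w xi))%:C%C * (cx (stereo_inv w))%:C%C +
  (cy (tangent w xi))%:C%C * (cy (stereo_inv w))%:C%C +
  (cz (tangent w xi))%:C%C * (cz (stereo_inv w))%:C%C : C).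
  by rewrite -!rmorphM -!rmorphD.
rewrite sinv0 sinv1 sinv2 tangent0 tangent1 tangent2 rmorph0.
set s := conjc w * xi + w * conjc xi.
(* [field] treats [J] as a free variable, so [J^2 = -1] is used up beforehand. *)
have -> a b : - J * a * (- J * b / den w) = - (a * b / den w).
  by transitivity (J ^+ 2 * (a * b / den w)); [ring | rewrite sqr_i mulN1r].
by have := den0 w; rewrite /s /den => d; field.
Qed.

(** The right side is [-4 Im (conj xi * et) / den w ^+ 2]: the chart reverses orientation for the
    outward normal. This happens at source and target alike, so orientation preservation agrees on
    the sphere and in the plane. *)
Lemma det3_tangent w xi et :
  (det3 (stereo_inv w) (tangent w xi) (tangent w et))%:C%C =
  2 * J * (conjc xi * et - xi * conjc et) / den w ^+ 2.
Proof.
rewrite /det3 /cross dotvE !c_mkv.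
set T := tangent w xi; set T' := tangent w et; set s := stereo_inv w.
transitivity ((cx s)%:C%C * ((cy T)%:C%C * (cz T')%:C%C - (cz T)%:C%C * (cy T')%:C%C)
  + (cy s)%:C%C * ((cz T)%:C%C * (cx T')%:C%C - (cx T)%:C%C * (cz T')%:C%C)
  + (cz s)%:C%C * ((cx T)%:C%C * (cy T')%:C%C - (cy T)%:C%C * (cx T')%:C%C) : C).
  by rewrite -!(rmorphM, rmorphB, rmorphD).
rewrite /T /T' /s sinv0 sinv1 sinv2 !tangent0 !tangent1 !tangent2.
by have := den0 w; rewrite /den => d; field.
Qed.

End Chart.

(** * Linearity of directional derivatives *)

Section DeriveLinear.
Variable R : realType.
Variables (n : nat) (U : set 'rV[R]_n) (F : 'rV[R]_n -> 'rV[R]_n) (x : 'rV[R]_n).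
Hypothesis (Uo : open U) (Ux : U x).
Hypothesis F1 : forall y, U y -> forall v : 'rV[R]_n,
  derivable F y v /\ {for y, continuous (fun y => 'D_v F y)}.

Lemma C1_derive_sum (v : 'rV[R]_n) i :
  ('D_v F x) ord0 i = \sum_k v ord0 k * ('D_(delta_mx ord0 k) F x) ord0 i.
Proof.
have [Fv _] := F1 Ux v.
have Gv : derivable (fun z => F z ord0 i) x v by have /derivable_mxP := Fv; apply.
have -> : ('D_v F x) ord0 i = 'D_v (fun z => F z ord0 i) x by rewrite derive_mx // mxE.
set G := fun z => F z ord0 i; set s := \sum_k _.
apply: cvg_lim => //; apply/cvgrPdist_le => e e0.
pose M := \sum_k `|v ord0 k|.
have M0 : 0 <= M by apply: sumr_ge0.
have M1 : 0 < M + 1 by rewrite ltr_wpDl.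
have [d d0 Hd] := C1_strict Uo Ux F1 i (divr_gt0 e0 M1).
near=> h.
have h0 : h != 0 by near: h; exact: nbhs_dnbhs_neq.
have hd : `|h| < d / (M + 1) by near: h; apply: dnbhs0_lt; rewrite divr_gt0.
have vM k : `|v ord0 k| <= M by rewrite /M (bigD1 k) //= lerDl sumr_ge0.
have X1 k : `|(h *: v + x) ord0 k - x ord0 k| < d.
  rewrite !mxE addrK normrM; apply: le_lt_trans (_ : `|h| * (M + 1) < d); last first.
    by rewrite -ltr_pdivlMr.
  by rewrite ler_wpM2l // (le_trans (vM k)) // lerDl.
have X2 k : `|x ord0 k - x ord0 k| < d by rewrite subrr normr0.
have := Hd _ _ X1 X2.
have -> : \sum_k ((h *: v + x) ord0 k - x ord0 k) * ('D_(delta_mx ord0 k) F x) ord0 i = h * s.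
  by rewrite mulr_sumr; apply: eq_bigr => k _; rewrite !mxE addrK mulrA.
have -> : \sum_k `|(h *: v + x) ord0 k - x ord0 k| = `|h| * M.
  by rewrite mulr_sumr; apply: eq_bigr => k _; rewrite !mxE addrK normrM.
move=> H.
have -> : s - h^-1 *: ((G \o shift x) (h *: v) - G x) = - h^-1 * (G (h *: v + x) - G x - h * s).
  by rewrite /GRing.scale /=; field.
rewrite normrM normrN normfV mulrC ler_pdivrMr ?normr_gt0 //; apply: le_trans H _.
rewrite mulrCA mulrC ler_wpM2r // mulrAC ler_pdivrMr // ler_wpM2l ?(ltW e0) //.
by rewrite lerDl.
Unshelve. all: by end_near. Qed.

End DeriveLinear.

(** * The chain rule with the chart *)

Section ChartDerivative.
Variable R : realType.
Local Notation C := R[i].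
Variables (U : set (vec R)) (F : vec R -> vec R) (w : C).
Hypothesis (Uo : open U) (Uw : U (stereo_inv w)) (F1 : C1_on U F).

Let L (i k : 'I_3) : C := (('D_(delta_mx ord0 k) F (stereo_inv w)) ord0 i)%:C%C.

Lemma sdiff_C1_chart i :
  sdiff (fun v => (F (stereo_inv v) ord0 i)%:C%C) w
    (\sum_k L i k * dchart k w) (\sum_k L i k * conjc (dchart k w)).
Proof.
pose G v := \sum_k L i k * chart k v.
have sG : sdiff G w (\sum_k L i k * dchart k w) (\sum_k L i k * conjc (dchart k w)).
  rewrite !sum3.
  have sL k : sdiff (fun v => L i k * chart k v) w (L i k * dchart k w) (L i k * conjc (dchart k w)).
    by apply: sdiff_eq (sdiffM (sdiff_const (L i k) w) (sdiff_chart k w)) _ _; ring.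
  apply: sdiff_ext (_ : (fun v => L i (inord 0) * chart (inord 0) v +
     L i (inord 1) * chart (inord 1) v + L i (inord 2) * chart (inord 2) v) =1 _) _.
    by move=> v; rewrite /G sum3.
  exact: sdiffD (sdiffD (sL _) (sL _)) (sL _).
(* By [C1_strict], [F] minus its linear part has arbitrarily small Lipschitz constant near
   [stereo_inv w], and the chart is Lipschitz. *)
suff s0 : sdiff (fun v => (F (stereo_inv v) ord0 i)%:C%C - G v) w 0 0.
  apply: sdiff_ext (_ : (fun v => G v + ((F (stereo_inv v) ord0 i)%:C%C - G v)) =1 _) _.
    by move=> v /=; ring.
  by apply: sdiff_eq (sdiffD sG s0) _ _; rewrite addr0.
have [D D0 [d0 d00 Hl]] : exists2 D : R, 0 < D & exists2 d : R, 0 < d & forall x y k,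
    cmod (x - w) < d -> cmod (y - w) < d ->
    `|stereo_inv x ord0 k - stereo_inv y ord0 k| <= D * cmod (x - y).
  have H k := sdiff_lip (sdiff_chart k w).
  have [a a0 Ha] := H (inord 0); have [b b0 Hb] := H (inord 1); have [c c0 Hc] := H (inord 2).
  pose K k := cmod (dchart k w) + cmod (conjc (dchart k w)) + 1.
  have K0 k : 0 <= K k by rewrite !addr_ge0 ?cmod_ge0.
  exists (K (inord 0) + K (inord 1) + K (inord 2) + 1).
    by have := K0 (inord 0); have := K0 (inord 1); have := K0 (inord 2); lra.
  exists (Num.min a (Num.min b c)); first by rewrite !lt_min a0 b0.
  move=> x y k; rewrite !lt_min => /andP[xa /andP[xb xc]] /andP[ya /andP[yb yc]].
  have E k' : cmod (chart k' x - chart k' y) = `|stereo_inv x ord0 k' - stereo_inv y ord0 k'|.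
    by rewrite /chart -rmorphB cmodR.
  have n0 := cmod_ge0 (x - y).
  have W (t : R) k' : t <= K k' * cmod (x - y) ->
     t <= (K (inord 0) + K (inord 1) + K (inord 2) + 1) * cmod (x - y) .
    move=> h; apply: le_trans h _; rewrite ler_wpM2r //.
    have := K0 (inord 0); have := K0 (inord 1); have := K0 (inord 2) => ? ? ?.
    by move: k'; apply: forall3; lra.
  move: k; apply: forall3; apply: W; rewrite -E; [exact: Ha|exact: Hb|exact: Hc].
apply: (@sdiff_weak _ _ _ _ _ (3 * D)); first by rewrite mulr_gt0.
move=> e e0 _.
have [d d'0 Hd] := C1_strict Uo Uw F1 i e0.
exists (Num.min d0 (d / D)); first by rewrite lt_min d00 divr_gt0.
move=> x y; rewrite !lt_min !ltr_pdivlMr // => /andP[x0 x1] /andP[y0 y1].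
have w0 : cmod (w - w) < d0 by rewrite subrr cmod0.
have X k : `|stereo_inv x ord0 k - stereo_inv w ord0 k| < d.
  by apply: le_lt_trans (Hl _ _ k x0 w0) _; rewrite mulrC.
have Y k : `|stereo_inv y ord0 k - stereo_inv w ord0 k| < d.
  by apply: le_lt_trans (Hl _ _ k y0 w0) _; rewrite mulrC.
have := Hd _ _ X Y.
rewrite /rlin !mul0r addr0 subr0.
have -> : (F (stereo_inv x) ord0 i)%:C%C - G x - ((F (stereo_inv y) ord0 i)%:C%C - G y) =
  (F (stereo_inv x) ord0 i - F (stereo_inv y) ord0 i - \sum_k (stereo_inv x ord0 k - stereo_inv y ord0 k) *
    ('D_(delta_mx ord0 k) F (stereo_inv w)) ord0 i)%:C%C.
  rewrite !rmorphB rmorph_sum /=.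
  have -> : \sum_k ((stereo_inv x ord0 k - stereo_inv y ord0 k) *
    ('D_(delta_mx ord0 k) F (stereo_inv w)) ord0 i)%:C%C = G x - G y.
    rewrite /G -sumrB; apply: eq_bigr => k _.
    by rewrite -mulrBr rmorphM rmorphB mulrC.
  by ring.
rewrite cmodR => h; apply: le_trans h _.
rewrite [3 * D * e]mulrC -mulrA ler_wpM2l ?(ltW e0) // sum3.
rewrite (_ : 3 * D * _ = D * cmod (x - y) + D * cmod (x - y) + D * cmod (x - y)); last by ring.
by rewrite !lerD // Hl.
Qed.

End ChartDerivative.

(** * From diffeomorphisms of the sphere to the plane *)

Section PlanarDerivative.
Variable R : realType.
Local Notation C := R[i].
Let J : C := 'i%C.

(** Recovers a planar map [h] from the coordinates of [stereo_inv \o h], whose differentiability is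
    known. *)
Lemma chart_stereo (v : C) :
  v = (chart (inord 0) v + J * chart (inord 1) v) / (1 - chart (inord 2) v).
Proof.
have d : v * conjc v + 1 != 0.
  by rewrite -cmod_sqrE -(rmorph1 (real_complex R)) -rmorphD -cmod_gt0 cmodR normr_gt0 gt_eqF // ltr_wpDl // exprn_ge0 // cmod_ge0.
rewrite chart0E chart1E chart2E.
rewrite (_ : J * _ = - J ^+ 2 * (v - conjc v) / (v * conjc v + 1)); last by rewrite /J; ring.
rewrite sqr_i (_ : 1 - (1 - 2 / (v * conjc v + 1)) = 2 / (v * conjc v + 1)); last by ring.
by field.
Qed.

Lemma Diff1plus_planar (f : sph R -> sph R) (h : C -> C) : Diff1plus f ->
  (forall w, f (pt w) = pt (h w)) ->
  forall w, exists a b, sdiff h w a b /\ cmod b < cmod a.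
Proof.
move=> [_ [U [F [[Uo Uval Fval F1] Fo]]] _] fh w.
have Uw v : U (stereo_inv v) by rewrite -val_pt.
have Fh v : F (stereo_inv v) = stereo_inv (h v) by rewrite -!val_pt Fval fh.
have sF i := sdiff_C1_chart Uo (Uw w) F1 i.
have sC i : sdiff (fun v => chart i (h v)) w
   (\sum_k (('D_(delta_mx ord0 k) F (stereo_inv w)) ord0 i)%:C%C * dchart k w)
   (\sum_k (('D_(delta_mx ord0 k) F (stereo_inv w)) ord0 i)%:C%C * conjc (dchart k w)).
  by apply: sdiff_ext (sF i) => v; rewrite Fh.
have d0 : 1 - chart (inord 2) (h w) != 0.
  have d : h w * conjc (h w) + 1 != 0.
    by rewrite -cmod_sqrE -(rmorph1 (real_complex R)) -rmorphD -cmod_gt0 cmodR normr_gt0 gt_eqF // ltr_wpDl // exprn_ge0 // cmod_ge0.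
  by rewrite chart2E opprB addrCA subrr addr0 mulf_neq0 ?invr_eq0 // pnatr_eq0.
have [a [b sh]] : exists a b, sdiff h w a b.
  do 2 eexists; apply: sdiff_ext (_ : (fun v => (chart (inord 0) (h v) + J * chart (inord 1) (h v)) *
     (1 + -1 * chart (inord 2) (h v))^-1) =1 _) _.
    by move=> v; rewrite [RHS]chart_stereo mulN1r.
  apply: sdiffM; first by apply: sdiffD; [exact: sC|apply: sdiffM; [exact: sdiff_const|exact: sC]].
  apply: (sdiff_comp (f := fun x => x^-1)); first by apply: sdiffV; rewrite mulN1r.
  by apply: sdiffD; [exact: sdiff_const|apply: sdiffM; [exact: sdiff_const|exact: sC]].
exists a, b; split => //.
(* Both sides differentiate [F \o stereo_inv = stereo_inv \o h]; strict derivatives are unique. *)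
have DT xi : 'D_(tangent w xi) F (stereo_inv w) = tangent (h w) (rlin a b xi).
  apply/rowP => i; rewrite (C1_derive_sum Uo (Uw w) F1).
  apply: (@complexI R); rewrite tangentE rmorph_sum.
  have [E1 E2] := sdiff_uniq (sC i) (sdiff_comp (f := chart i) (sdiff_chart i (h w)) sh).
  rewrite (_ : rlin _ _ (rlin a b xi) = rlin (dchart i (h w) * a + conjc (dchart i (h w)) * conjc b)
    (dchart i (h w) * b + conjc (dchart i (h w)) * conjc a) xi); last first.
    by rewrite /rlin; conj_push; ring.
  rewrite -E1 -E2 /rlin !mulr_suml -big_split /=.
  by apply: eq_bigr => k _; rewrite rmorphM /= tangentE /rlin; ring.
have JJ : conjc J = - J by rewrite /J; simpc.
have J2 : J * J = -1 by rewrite -expr2 sqr_i.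
have posC (v : C) (t c : R) : t%:C%C = c%:C%C / (v * conjc v + 1) ^+ 2 -> (0 < t) = (0 < c).
  have n0 : 0 < cmod v ^+ 2 + 1 by rewrite ltr_wpDl // exprn_ge0 // cmod_ge0.
  rewrite -cmod_sqrE -(rmorph1 (real_complex R)) -rmorphD -rmorphXn -fmorphV -rmorphM.
  by move=> /complexI ->; rewrite pmulr_lgt0 // invr_gt0 exprn_gt0.
(* In this order [(i, 1)] is positively oriented, as the chart reverses orientation; its image is
   positive exactly when [|b| < |a|]. *)
have := Fo (pt w) (tangent w J) (tangent w 1).
rewrite val_pt !tangent_orth => /(_ erefl erefl).
rewrite fh val_pt !DT.
have -> : 0 < det3 (stereo_inv w) (tangent w J) (tangent w 1).
  rewrite (posC w _ 4) // det3_tangent JJ conjc1 rmorph_nat.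
  rewrite (_ : 2 * J * _ = - 4 * (J * J)); last by ring.
  by rewrite J2 mulrN1 opprK.
move=> /(_ isT).
rewrite (posC (h w) _ (4 * (cmod a ^+ 2 - cmod b ^+ 2))).
  by rewrite pmulr_rgt0 // subr_gt0 ltr_cmod.
rewrite det3_tangent; congr (_ / _).
have -> : (4 * (cmod a ^+ 2 - cmod b ^+ 2))%:C%C = 4 * (a * conjc a - b * conjc b) :> C.
  by rewrite -!cmod_sqrE -rmorphB -[4 : C](rmorph_nat (real_complex R)) -rmorphM.
rewrite /rlin; conj_push; rewrite JJ.
rewrite (_ : 2 * J * _ = - 4 * (J * J) * (a * conjc a - b * conjc b)); last by ring.
by rewrite J2 mulrN1 opprK.
Qed.

End PlanarDerivative.

(** * Moebius transformations and 4-transitivity *)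

Section Moebius.
Variable R : realType.
Local Notation C := R[i].
Local Notation S2 := (sph R).
Local Notation npole := (npole R).

Definition plane_map (h : C -> C) (p : S2) : S2 :=
  if val p == North R then npole else pt (h (stereo (val p))).

Lemma plane_map_pt h w : plane_map h (pt w) = pt (h w).
Proof. by rewrite /plane_map val_pt (negPf (stereo_inv_North w)) stereo_invK. Qed.

Lemma plane_map_npole h : plane_map h npole = npole.
Proof. by rewrite /plane_map val_npole eqxx. Qed.

Lemma sph_ext (f g : S2 -> S2) : f npole = g npole -> (forall w, f (pt w) = g (pt w)) ->
  f = g.
Proof. by move=> hi hp; apply/funext => p; case: (sph_cases p) => [->|[w ->]]. Qed.

Lemma plane_map_comp f g : plane_map (f \o g) = plane_map f \o plane_map g.
Proof. by apply: sph_ext => [|w] /=; rewrite ?plane_map_npole ?plane_map_pt. Qed.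

Lemma plane_map_id : plane_map id = id.
Proof. by apply: sph_ext => [|w] /=; rewrite ?plane_map_npole ?plane_map_pt. Qed.

Lemma fix_npole_plane_map (k : S2 -> S2) : injective k -> k npole = npole ->
  exists h, k = plane_map h.
Proof.
move=> kI ki; exists (fun w => stereo (val (k (pt w)))); apply: sph_ext => [|w].
  by rewrite plane_map_npole.
rewrite plane_map_pt; case: (sph_cases (k (pt w))) => [|[v ->]].
  by move=> e; case: (@pt_npole R w); apply: kI; rewrite e ki.
by rewrite val_pt stereo_invK.
Qed.

Definition inversion (p : S2) : S2 :=
  if val p == North R then pt 0
  else if stereo (val p) == 0 then npole else pt (- (stereo (val p))^-1).

Lemma inversion_npole : inversion npole = pt 0.
Proof. by rewrite /inversion val_npole eqxx. Qed.

Lemma inversion_0 : inversion (pt 0) = npole.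
Proof. by rewrite /inversion val_pt (negPf (stereo_inv_North _)) stereo_invK eqxx. Qed.

Lemma inversion_pt w : w != 0 -> inversion (pt w) = pt (- w^-1).
Proof.
by move=> w0; rewrite /inversion val_pt (negPf (stereo_inv_North _)) stereo_invK (negPf w0).
Qed.

Lemma inversionK : involutive inversion.
Proof.
move=> p; case: (sph_cases p) => [->|[w ->]]; first by rewrite inversion_npole inversion_0.
have [->|w0] := eqVneq w 0; first by rewrite inversion_0 inversion_npole.
by rewrite !inversion_pt ?oppr_eq0 ?invr_eq0 // invrN opprK invrK.
Qed.

Definition moebius (a b c d : C) (p : S2) : S2 :=
  if val p == North R then (if c == 0 then npole else pt (a / c))
  else let w := stereo (val p) in
       if c * w + d == 0 then npole else pt ((a * w + b) / (c * w + d)).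

Lemma moebius_npole a b c d :
  moebius a b c d npole = if c == 0 then npole else pt (a / c).
Proof. by rewrite /moebius val_npole eqxx. Qed.

Lemma moebius_pt a b c d w : moebius a b c d (pt w) =
  if c * w + d == 0 then npole else pt ((a * w + b) / (c * w + d)).
Proof. by rewrite /moebius val_pt (negPf (stereo_inv_North w)) stereo_invK. Qed.

Lemma MobP (f : S2 -> S2) :
  Mob f <-> exists a b c d, a * d - b * c = 1 /\ f = moebius a b c d.
Proof.
have E a b c d p : val (moebius a b c d p) = mob_vec a b c d (val p).
  by rewrite /moebius /mob_vec; case: ifP => _; case: ifP.
split=> [[a [b [c [d [D H]]]]]|[a [b [c [d [D ->]]]]]]; exists a, b, c, d; split=> //.
by apply/funext => p; apply/val_inj; rewrite E H.
Qed.

Definition affine (a b : C) := plane_map (fun w => a * w + b).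

(** A description of the Moebius group without matrices, so that facts about it reduce to affine
    maps and [z |-> -1/z]. *)
Inductive generated : (S2 -> S2) -> Prop :=
| generated_affine a b : a != 0 -> generated (affine a b)
| generated_inversion : generated inversion
| generated_comp f g : generated f -> generated g -> generated (f \o g).

Lemma Mob_generated f : Mob f -> generated f.
Proof.
move=> /MobP[a [b [c [d [D ->]]]]].
have [c0|c0] := eqVneq c 0.
  have ad : a * d = 1 by rewrite -D c0 mulr0 subr0.
  have d0 : d != 0 by apply: contraTneq (oner_neq0 C) => d0; rewrite -ad d0 mulr0 eqxx.
  have a0 : a != 0 by apply: contraTneq (oner_neq0 C) => a0; rewrite -ad a0 mul0r eqxx.
  have -> : moebius a b c d = affine (a / d) (b / d).
    apply: sph_ext => [|w]; first by rewrite moebius_npole /affine plane_map_npole c0 eqxx.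
    rewrite moebius_pt /affine plane_map_pt c0 mul0r add0r (negPf d0).
    by congr pt; field.
  by apply: generated_affine; rewrite mulf_neq0 ?invr_eq0.
(* For determinant 1, [(a z + b)/(c z + d) = a/c - 1/(c^2 z + c d)]. *)
have -> : moebius a b c d = affine 1 (a / c) \o (inversion \o affine (c ^+ 2) (c * d)).
  apply: sph_ext => [|w] /=.
    rewrite moebius_npole /affine plane_map_npole inversion_npole plane_map_pt (negPf c0).
    by rewrite mulr0 add0r.
  rewrite moebius_pt /affine plane_map_pt.
  rewrite (_ : c ^+ 2 * w + c * d = c * (c * w + d)); last by ring.
  have [cw|cw] := eqVneq (c * w + d) 0; first by rewrite cw mulr0 inversion_0 plane_map_npole.
  rewrite inversion_pt ?mulf_neq0 // plane_map_pt; congr pt.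
  have -> : b = (a * d - 1) / c by rewrite -D; field.
  by field; rewrite c0 cw.
by do 2?apply: generated_comp; [apply: generated_affine; rewrite oner_neq0|
  apply: generated_inversion | apply: generated_affine; rewrite expf_neq0].
Qed.

(** The extra factor [f] strengthens the induction: only left multiplication of a matrix by a
    generator has to be computed. *)
Lemma generated_Mob_comp m f : generated m -> Mob f -> Mob (m \o f).
Proof.
move=> gm; elim: gm f => {m} [al be al0|| f g _ IHf _ IHg] k; last first.
- by move=> /IHg /IHf.
- move=> /MobP[a [b [c [d [D ->]]]]]; apply/MobP.
  exists (- c), (- d), a, b; split; first by rewrite -D; ring.
  have det w : a * w + b = 0 -> c * w + d = 0 -> False.
    move=> h1 h2; have /eqP := D; rewrite (_ : _ - _ = a * (c * w + d) - c * (a * w + b)).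
      by rewrite h1 h2 !mulr0 subr0 eq_sym oner_eq0.
    by ring.
  apply: sph_ext => [|w] /=.
    rewrite !moebius_npole; have [c0|c0] := eqVneq c 0.
      rewrite inversion_npole; have [a0|a0] := eqVneq a 0.
        by have /eqP := D; rewrite a0 c0 mul0r mulr0 subr0 eq_sym oner_eq0.
      by rewrite c0 oppr0 mul0r.
    have [->|a0] := eqVneq a 0; first by rewrite mul0r inversion_0.
    by rewrite inversion_pt ?mulf_neq0 ?invr_eq0 //; congr pt; field; rewrite a0.
  rewrite !moebius_pt; have [c0|c0] := eqVneq (c * w + d) 0.
    rewrite inversion_npole; have [a0|a0] := eqVneq (a * w + b) 0; first by have := det w a0 c0.
    by rewrite mulNr -opprD c0 oppr0 mul0r.
  have [a0|a0] := eqVneq (a * w + b) 0; first by rewrite a0 mul0r inversion_0.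
  by rewrite inversion_pt ?mulf_neq0 ?invr_eq0 //; congr pt; field; rewrite a0.
- move=> /MobP[a [b [c [d [D ->]]]]]; apply/MobP.
  (* The affine map has matrix [[[s, be/s], [0, 1/s]]] of determinant 1. *)
  pose s := sqrtc al; have s2 : al = s ^+ 2 by rewrite sqr_sqrtc.
  have s0 : s != 0 by rewrite sqrtc_eq0.
  exists (s * a + be / s * c), (s * b + be / s * d), (c / s), (d / s); split.
    by rewrite -D; field.
  apply: sph_ext => [|w] /=.
    rewrite !moebius_npole /affine mulf_eq0 invr_eq0 (negPf s0) orbF.
    have [c0|c0] := eqVneq c 0; first by rewrite plane_map_npole.
    by rewrite plane_map_pt s2; congr pt; field; rewrite c0 s0.
  rewrite !moebius_pt /affine (_ : c / s * w + d / s = (c * w + d) / s); last by ring.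
  rewrite mulf_eq0 invr_eq0 (negPf s0) orbF.
  have [c0|c0] := eqVneq (c * w + d) 0; first by rewrite plane_map_npole.
  by rewrite plane_map_pt s2; congr pt; field; rewrite c0 s0.
Qed.

Lemma generated_id : generated id.
Proof.
have -> : id = affine 1 0 by apply: sph_ext => [|w]; rewrite /affine ?plane_map_npole ?plane_map_pt ?mul1r ?addr0.
by apply: generated_affine; rewrite oner_neq0.
Qed.

Lemma Mob_id : Mob (@id S2).
Proof.
apply/MobP; exists 1, 0, 0, 1; split; first by ring.
apply: sph_ext => [|w]; first by rewrite moebius_npole eqxx.
by rewrite moebius_pt mul0r add0r oner_eq0 mul1r addr0 divr1.
Qed.

Lemma generated_Mob f : generated f -> Mob f.
Proof. by move=> gf; have := generated_Mob_comp gf Mob_id. Qed.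

Lemma affineK a b : a != 0 -> cancel (affine a b) (affine a^-1 (- b / a)).
Proof.
move=> a0 p; case: (sph_cases p) => [->|[w ->]]; rewrite /affine ?plane_map_npole // !plane_map_pt.
by congr pt; field.
Qed.

Lemma affineVK a b : a != 0 -> cancel (affine a^-1 (- b / a)) (affine a b).
Proof.
move=> a0 p; case: (sph_cases p) => [->|[w ->]]; rewrite /affine ?plane_map_npole // !plane_map_pt.
by congr pt; field.
Qed.

Lemma three_transitive (a b c : S2) : a <> b -> a <> c -> b <> c ->
  exists m m', [/\ generated m, generated m', cancel m m', cancel m' m &
    [/\ m a = pt 0, m b = pt 1 & m c = npole]].
Proof.
move=> ab ac bc.
(* First [c] goes to the pole by a translation and the inversion; an affine map then places the
   other two points. *)
have [n [n' [gn gn' nK n'K nc]]] : exists n n', [/\ generated n, generated n',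
    cancel n n', cancel n' n & n c = npole].
  case: (sph_cases c) => [->|[w ->]].
    by exists id, id; split=> //; apply: generated_id.
  have o1 : 1 != 0 :> C := oner_neq0 _.
  exists (inversion \o affine 1 (- w)), (affine 1^-1 (- - w / 1) \o inversion); split.
  - by apply: generated_comp; [exact: generated_inversion|exact: generated_affine].
  - by apply: generated_comp; [apply: generated_affine; rewrite invr1|exact: generated_inversion].
  - by move=> p /=; rewrite inversionK affineK.
  - by move=> p /=; rewrite affineVK // inversionK.
  - by rewrite /= /affine plane_map_pt mul1r subrr inversion_0.
have nI := can_inj nK.
case: (sph_cases (n a)) => [|[u nu]]; first by rewrite -nc => /nI.
case: (sph_cases (n b)) => [|[v nv]]; first by rewrite -nc => /nI.
have uv : v - u != 0.
  by rewrite subr_eq0; apply/eqP => e; apply: ab; apply: nI; rewrite nu nv e.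
pose k := (v - u)^-1.
have k0 : k != 0 by rewrite invr_eq0.
exists (affine k (- u * k) \o n), (n' \o affine k^-1 (- (- u * k) / k)); split.
- by apply: generated_comp => //; exact: generated_affine.
- by apply: generated_comp => //; apply: generated_affine; rewrite invr_eq0.
- by move=> p /=; rewrite affineK.
- by move=> p /=; rewrite n'K affineVK.
- rewrite /= nu nv nc /affine !plane_map_pt plane_map_npole; split=> //; congr pt; rewrite /k; field => //.
Qed.

End Moebius.

(** * Four-transitivity of a subgroup larger than the Moebius group *)

Section FourTransitive.
Variable R : realType.
Local Notation C := R[i].
Local Notation S2 := (sph R).
Local Notation npole := (npole R).
Variable H : set (S2 -> S2).
Hypotheses (HD : subgroup_Diff H) (HM : @Mob R `<=` H).

Let Hcomp f g : H f -> H g -> H (f \o g). Proof. by have [_ _ h _] := HD; apply: h. Qed.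

Let Hinj f : H f -> injective f.
Proof. by have [_ _ _ h] := HD => /h[g [_ /can_inj]]. Qed.

Lemma subgroup_generated m : generated m -> H m.
Proof. by move=> /generated_Mob /HM. Qed.

Lemma subgroup_planar : planar_group [set h | H (plane_map h)].
Proof.
split=> /=.
- by move=> f g Hf Hg; rewrite plane_map_comp; apply: Hcomp.
- move=> f Hf; have [_ _ _ /(_ _ Hf)[g [Hg fK gK]]] := HD.
  have gi : g npole = npole by rewrite -{1}(plane_map_npole f) fK.
  have [g' gE] := fix_npole_plane_map (Hinj Hg) gi; rewrite {}gE in Hg fK gK.
  exists g'; split=> // w; apply: pt_inj; first by rewrite -!plane_map_pt fK.
  by rewrite -!plane_map_pt gK.
- by move=> a b a0; apply: subgroup_generated; apply: generated_affine.
- move=> f Hf w; apply: (Diff1plus_planar (f := plane_map f)); last exact: plane_map_pt.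
  by have [h _ _ _] := HD; apply: h.
- move=> f Hf f0.
  have Hk : H (@inversion R \o (plane_map f \o @inversion R)).
    have gi := subgroup_generated (generated_inversion R).
    by apply: Hcomp => //; apply: Hcomp.
  have ki : (@inversion R \o (plane_map f \o @inversion R)) npole = npole.
    by rewrite /= inversion_npole plane_map_pt f0 inversion_0.
  have [k kE] := fix_npole_plane_map (Hinj Hk) ki.
  exists k; first by rewrite -kE.
  move=> q q0; apply: pt_inj; rewrite -plane_map_pt -kE /= inversion_pt // plane_map_pt inversion_pt //.
  apply: contra q0 => /eqP fq; have : plane_map f (pt (- q^-1)) = plane_map f (pt 0).
    by rewrite !plane_map_pt fq f0.
  by move=> /(Hinj Hf) /pt_inj /eqP; rewrite oppr_eq0 invr_eq0.
Qed.

Let pt01 : pt (0 : C) <> pt 1.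
Proof. by move=> /pt_inj /eqP; rewrite eq_sym oner_eq0. Qed.

(** Compose [f] with a Moebius map taking the images of 0, 1, infinity back to 0, 1, infinity. *)
Lemma normalize_nonMob f : H f -> ~ Mob f -> exists h,
  [/\ H (plane_map h), ~ Mob (plane_map h), h 0 = 0 & h 1 = 1].
Proof.
move=> Hf nM; have fI := Hinj Hf.
have [| | |m [m' [gm gm' mK m'K [m0 m1 mi]]]] :=
  @three_transitive R (f (pt 0)) (f (pt 1)) (f npole).
- by move=> /fI.
- by move=> /fI /pt_npole.
- by move=> /fI /pt_npole.
have Hk : H (m \o f) by apply: Hcomp => //; apply: subgroup_generated.
have [h hE] := fix_npole_plane_map (Hinj Hk) mi.
exists h; split; first by rewrite -hE.
- rewrite -hE => Mk; apply: nM.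
  rewrite (_ : f = m' \o (m \o f)); first exact: generated_Mob_comp.
  by apply/funext => p /=; rewrite mK.
- by apply: pt_inj; rewrite -plane_map_pt -hE.
- by apply: pt_inj; rewrite -plane_map_pt -hE.
Qed.

Theorem four_transitive : (exists f, H f /\ ~ Mob f) ->
  forall p q : 'I_4 -> S2, injective p -> injective q ->
  exists2 g, H g & forall i, g (p i) = q i.
Proof.
move=> [f [/normalize_nonMob nf /nf[h [Hh nMh h0 h1]]]] p q pI qI.
have naff a b : exists w, h w <> a * w + b.
  apply/existsNP => hE; apply: nMh; apply: generated_Mob.
  have -> : h = (fun w => a * w + b) by apply/funext.
  apply: generated_affine; apply/eqP => a0.
  by apply: pt01; rewrite -h0 -h1 !hE a0 !mul0r.
have trans := planar_transitive subgroup_planar Hh naff.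
(* Normal form of a quadruple: 0, 1, infinity and a generic [z]. *)
have std (r : 'I_4 -> S2) : injective r -> exists m m' z, [/\ H m, H m', cancel m m' &
    [/\ m (r (inord 0)) = pt 0, m (r (inord 1)) = pt 1, m (r (inord 2)) = npole,
     m (r (inord 3)) = pt z & generic z]].
  move=> rI; have ne i j : (i < 4)%N -> (j < 4)%N -> i != j -> r (inord i) <> r (inord j).
    by move=> hi hj ij /rI /(congr1 val); rewrite /= !inordK // => /eqP; apply/negP.
  have [| | |m [m' [gm gm' mK m'K [m0 m1 mi]]]] :=
    @three_transitive R (r (inord 0)) (r (inord 1)) (r (inord 2)); try exact: ne.
  have mI := can_inj mK.
  case: (sph_cases (m (r (inord 3)))) => [|[z mz]].
    by rewrite -mi => /mI e; case: (@ne 3 2 isT isT isT e).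
  exists m, m', z; split=> //; try exact: subgroup_generated.
  split=> //; apply/andP; split; apply/eqP => z0; rewrite {}z0 in mz.
    by move: mz; rewrite -m0 => /mI e; case: (@ne 3 0 isT isT isT e).
  by move: mz; rewrite -m1 => /mI e; case: (@ne 3 1 isT isT isT e).
have [m [m' [z [Hm Hm' mK [m0 m1 mi mz gz]]]]] := std p pI.
have [n [n' [w [Hn Hn' nK [n0 n1 ni nw gw]]]]] := std q qI.
have [k [Hk k0 k1 kz]] := trans z w gz gw.
exists (n' \o (plane_map k \o m)); first by apply: Hcomp => //; apply: Hcomp.
have ord4 (i : 'I_4) : [\/ i = inord 0, i = inord 1, i = inord 2 | i = inord 3].
  case: i => [[|[|[|[|//]]]] hi]; [constructor 1|constructor 2|constructor 3|constructor 4];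
  by apply/val_inj; rewrite /= inordK.
move=> i /=; case: (ord4 i) => ->.
- by rewrite m0 plane_map_pt k0 -n0 nK.
- by rewrite m1 plane_map_pt k1 -n1 nK.
- by rewrite mi plane_map_npole -ni nK.
- by rewrite mz plane_map_pt kz -nw nK.
Qed.

End FourTransitive.

(** * The identity component *)

Section UniformContinuity.
Variable R : realType.
Local Notation S2 := (sph R).

Definition sphere : set (vec R) := [set p | dotv p p == 1].

Lemma sphere_compact : compact sphere.
Proof.
apply: bounded_closed_compact.
  exists 1; split; first exact: num_real.
  move=> x x1 p /eqP; rewrite dotvE => hp.
  rewrite /= [`|p|]/Num.Def.normr /= mx_normrE; apply: bigmax_le; first by lra.
  move=> [i k] _ /=; rewrite (ord1 i); apply: le_trans (ltW x1).
  have cle (t : R) : t * t <= 1 -> `|t| <= 1.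
    by move=> t1; rewrite -(ler_sqr (normr_ge0 t)) ?nnegrE // real_normK ?num_real // expr1n expr2.
  have hx := sqr_ge0 (cx p); have hy := sqr_ge0 (cy p); have hz := sqr_ge0 (cz p).
  rewrite !expr2 in hx hy hz.
  by move: k; apply: forall3; rewrite -/(cx p) -/(cy p) -/(cz p); apply: cle; lra.
have -> : sphere = (fun p : vec R => dotv p p) @^-1` [set 1].
  by apply/seteqP; split => p; rewrite /sphere /= => /eqP.
apply: preimage_closed; last exact: closed_eq.
rewrite (_ : (fun p : vec R => dotv p p) = (fun p : vec R => cx p * cx p + cy p * cy p + cz p * cz p)).
  have cc i (p : vec R) : {for p, continuous (fun p : vec R => p ord0 i)} by exact: coord_continuous.
  have c2 i p := continuousM (cc i p) (cc i p).
  by move=> p _; exact: (continuousD (continuousD (c2 (inord 0) p) (c2 (inord 1) p)) (c2 (inord 2) p)).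
by apply/funext => p; rewrite dotvE.
Qed.

(** Makes composition with a fixed element continuous for the uniform metric. The extension [F] is
    locally Lipschitz, and compactness makes the radius uniform. *)
Lemma Diff1plus_ucont (f : S2 -> S2) : Diff1plus f -> forall e : R, 0 < e ->
  exists2 d : R, 0 < d & forall p q, Defs.edist (val p) (val q) < d ->
    Defs.edist (val (f p)) (val (f q)) < e.
Proof.
move=> [[U [F [Uo Uval Fval F1]]] _ _] e e0.
have loc x : sphere x -> exists2 r : R, 0 < r & forall y z : vec R,
    (forall k, `|y ord0 k - x ord0 k| < r) -> (forall k, `|z ord0 k - x ord0 k| < r) ->
    Defs.edist (F y) (F z) < e.
  move=> sx; have Ux : U x by have := Uval (exist _ x sx).
  pose M := \sum_i \sum_k `|('D_(delta_mx ord0 k) F x) ord0 i| + 3.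
  have M0 : 0 < M by rewrite ltr_wpDl //; apply: sumr_ge0 => i _; apply: sumr_ge0.
  have Mi i : \sum_k `|('D_(delta_mx ord0 k) F x) ord0 i| + 1 <= M.
    have : \sum_k `|('D_(delta_mx ord0 k) F x) ord0 i| <=
        \sum_i \sum_k `|('D_(delta_mx ord0 k) F x) ord0 i|.
      by rewrite [leRHS](bigD1 i) //= lerDl; apply: sumr_ge0 => j _; apply: sumr_ge0.
    by rewrite /M; lra.
  have H i := C1_strict Uo Ux F1 i ltr01.
  have [a a0 Ha] := H (inord 0); have [b b0 Hb] := H (inord 1); have [c c0 Hc] := H (inord 2).
  (* Each coordinate of [F y - F z] will be at most [6 m M]; three of them give [18 m M < e]. *)
  pose m := e / (20 * M).
  have m0 : 0 < m by rewrite divr_gt0 // mulr_gt0.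
  exists (Num.min m (Num.min a (Num.min b c))); first by rewrite !lt_min m0 a0 b0.
  move=> y z hy hz.
  have bnd i : `|F y ord0 i - F z ord0 i -
       \sum_k (y ord0 k - z ord0 k) * ('D_(delta_mx ord0 k) F x) ord0 i| <=
       1 * \sum_k `|y ord0 k - z ord0 k|.
    by move: i; apply: forall3; [apply: Ha | apply: Hb | apply: Hc] => k;
    have := hy k; have := hz k; rewrite !lt_min => /andP[_ /andP[? /andP[? ?]]] /andP[_ /andP[? /andP[? ?]]].
  have yz k : `|y ord0 k - z ord0 k| <= 2 * m.
    have := hy k; have := hz k; rewrite !lt_min => /andP[h1 _] /andP[h2 _].
    apply: le_trans (ler_distD (x ord0 k) _ _) _; rewrite (distrC (x ord0 k)); lra.
  have Fi i : `|F y ord0 i - F z ord0 i| <= 6 * m * M.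
    have S1 : \sum_k `|y ord0 k - z ord0 k| <= 6 * m.
      by rewrite sum3; have := yz (inord 0); have := yz (inord 1); have := yz (inord 2); lra.
    have S2' : `|\sum_k (y ord0 k - z ord0 k) * ('D_(delta_mx ord0 k) F x) ord0 i| <=
        2 * m * \sum_k `|('D_(delta_mx ord0 k) F x) ord0 i|.
      apply: le_trans (ler_norm_sum _ _ _) _; rewrite mulr_sumr; apply: ler_sum => k _.
      by rewrite normrM ler_wpM2r.
    have := bnd i; set s := \sum_k (y ord0 k - z ord0 k) * _ in S2' * => h.
    have h3 := ler_normD (F y ord0 i - F z ord0 i - s) s; rewrite subrK in h3.
    have h4 := Mi i; set t := \sum_k `|('D_ _ F x) ord0 i| in S2' h4.
    have h5 : 6 * m * (t + 1) <= 6 * m * M by rewrite ler_wpM2l // mulr_ge0 // ltW.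
    have t0 : 0 <= m * t by rewrite mulr_ge0 ?(ltW m0) //; apply: sumr_ge0.
    lra.
  apply: le_lt_trans (sdist_triangle_max _ _) _.
  have := Fi (inord 0); have := Fi (inord 1); have := Fi (inord 2).
  rewrite -!/(cx _) -!/(cy _) -!/(cz _) => h1 h2 h3.
  have : 20 * (m * M) = e by rewrite /m; field; rewrite gt_eqF.
  lra.
pose P (d : R) (x : vec R) := forall z : vec R,
    (forall k, `|z ord0 k - x ord0 k| < d) -> Defs.edist (F x) (F z) < e.
have [d d0 Hd] : exists2 d : R, 0 < d & sphere `<=` P d.
  have /compact_near_coveringP NC := sphere_compact.
  have : \forall d \near (0 : R)^'+, sphere `<=` P d.
    (* Half the radius for [y] and half for the step from [y] to [z] keep both within [r] of [x]. *)
    apply: NC => x /loc[r r0 Hr].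
    exists ([set y : vec R | forall k, `|y ord0 k - x ord0 k| < r / 2], [set d : R | d < r / 2]).
      split => /=.
        apply/nbhs_ballP; exists (r / 2); first by rewrite /= divr_gt0.
        move=> y; rewrite -ball_normE /= => h k; rewrite distrC.
        by apply: le_lt_trans h; have := rV_norm_coord (x - y) k; rewrite !mxE.
      by apply: nbhs_right_lt; rewrite divr_gt0.
    move=> [y d] /= [hy hd] z hz; apply: Hr => k; first by have := hy k; lra.
    by apply: le_lt_trans (ler_distD (y ord0 k) _ _) _; have := hy k; have := hz k; lra.
  move=> [d /= d0 H]; exists (d / 2); first by rewrite divr_gt0.
  by apply: H; rewrite /= ?divr_gt0 // sub0r normrN gtr0_norm ?divr_gt0 //; lra.
exists d => // p q pq; rewrite -!Fval; apply: (Hd (val p)); first exact: (proj2_sig p).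
move=> k; rewrite distrC; exact: le_lt_trans (sdist_coord _ _ k) pq.
Qed.

End UniformContinuity.

(** * Arcs in the group and the component of the identity *)

Section IdentityComponent.
Variable R : realType.
Local Notation C := R[i].
Local Notation S2 := (sph R).
Local Notation inv := (@inversion R).
Variable G : set (S2 -> S2).
Hypotheses (GD : subgroup_Diff G) (GM : @Mob R `<=` G).

Definition arc_component : set (S2 -> S2) := [set h | exists g : R -> S2 -> S2,
  [/\ forall t, 0 <= t <= 1 -> G (g t), g 0 = id, unif_cont01 g & g 1 = h]].

Let Gcomp f g : G f -> G g -> G (f \o g). Proof. by have [_ _ h _] := GD; apply: h. Qed.
Let Gid : G id. Proof. by have [_ h _ _] := GD. Qed.
Let G1 : 0 <= (1 : R) <= 1. Proof. by rewrite ler01 lexx. Qed.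

Let Gucont f : G f -> forall e : R, 0 < e -> exists2 d : R, 0 < d &
  forall p q, Defs.edist (val p) (val q) < d -> Defs.edist (val (f p)) (val (f q)) < e.
Proof. by have [h _ _ _] := GD => /h; apply: Diff1plus_ucont. Qed.

Lemma arc_component_sub : arc_component `<=` G.
Proof. by move=> h [g [Gg _ _ <-]]; apply: Gg; exact: G1. Qed.

Lemma arc_component_id : arc_component id.
Proof.
exists (fun=> id); split=> // t _ e e0; exists 1 => // s _ _ p.
by rewrite sdist_refl.
Qed.

Lemma arc_component_comp f g : arc_component f -> arc_component g ->
  arc_component (f \o g).
Proof.
move=> [F [GF F0 cF F1]] [K [GK K0 cK K1]].
exists (fun t => F t \o K t); split.
- by move=> t t01; apply: Gcomp; [exact: GF|exact: GK].
- by rewrite F0 K0.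
- move=> t t01 e e0; have e2 : 0 < e / 2 by rewrite divr_gt0.
  have [d d0 Hd] := Gucont (GF t t01) e2.
  have [a a0 Ha] := cF t t01 _ e2; have [b b0 Hb] := cK t t01 _ d0.
  exists (Num.min a b); first by rewrite lt_min a0.
  move=> s s01; rewrite lt_min => /andP[sa sb] p /=.
  apply: le_lt_trans (sdist_triangle (val (F t (K s p))) _ _) _.
  have := Ha s s01 sa (K s p); have := Hd _ _ (Hb s s01 sb p); lra.
- by rewrite F1 K1.
Qed.

(** Running the arc of [f] backwards and composing with the inverse of [f] joins the identity to
    that inverse; this sidesteps continuity of taking inverses. *)
Lemma arc_component_inv f : arc_component f -> exists g,
  [/\ arc_component g, cancel f g & cancel g f].
Proof.
move=> Af; have [_ _ _ /(_ _ (arc_component_sub Af))[g [Gg fK gK]]] := GD.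
exists g; split=> //; case: Af => F [GF F0 cF F1].
have r01 (t : R) : 0 <= t <= 1 -> 0 <= 1 - t <= 1 by move=> /andP[? ?]; apply/andP; split; lra.
exists (fun t => F (1 - t) \o g); split.
- by move=> t t01; apply: Gcomp => //; apply: GF; apply: r01.
- by rewrite subr0 F1; apply/funext => p /=; rewrite gK.
- move=> t t01 e e0; have [d d0 Hd] := cF (1 - t) (r01 _ t01) e e0.
  exists d => // s s01 st p /=; apply: Hd; first exact: r01.
  by rewrite (_ : 1 - s - (1 - t) = t - s) 1?distrC //; ring.
- by rewrite subrr F0.
Qed.

Lemma arc_component_conj f f' g : G f -> G f' -> cancel f f' ->
  arc_component g -> arc_component (f' \o (g \o f)).
Proof.
move=> Gf Gf' fK [K [GK K0 cK K1]].
exists (fun t => f' \o (K t \o f)); split.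
- by move=> t t01; apply: Gcomp => //; apply: Gcomp => //; apply: GK.
- by rewrite K0; apply/funext => p /=; rewrite fK.
- move=> t t01 e e0; have [d d0 Hd] := Gucont Gf' e0.
  have [a a0 Ha] := cK t t01 _ d0.
  by exists a => // s s01 sa p /=; apply: Hd; apply: Ha.
- by rewrite K1.
Qed.

Lemma arc_component_subgroup : subgroup_Diff arc_component.
Proof.
split; [|exact: arc_component_id|exact: arc_component_comp|exact: arc_component_inv].
by move=> h /arc_component_sub; have [H _ _ _] := GD; apply: H.
Qed.

Lemma arc_component_translation (b : C) : arc_component (affine 1 b).
Proof.
exists (fun t => affine 1 (t%:C%C * b)); split.
- by move=> t _; apply: (subgroup_generated GM); apply: generated_affine; exact: oner_neq0.
- apply: sph_ext => [|w]; rewrite /affine ?plane_map_npole ?plane_map_pt //.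
  by rewrite mul0r addr0 mul1r.
- move=> t _ e e0; have K0 : 0 < 2 * cmod b + 1 by rewrite ltr_wpDl // mulr_ge0 // cmod_ge0.
  exists (e / (2 * cmod b + 1)); first by rewrite divr_gt0.
  move=> s _; rewrite ltr_pdivlMr // => st p.
  case: (sph_cases p) => [->|[w ->]]; rewrite /affine ?plane_map_npole ?sdist_refl // !plane_map_pt.
  apply: le_lt_trans (sdist_pt _ _) _; apply: le_lt_trans st.
  rewrite (_ : _ - _ = (s - t)%:C%C * b); last by rewrite rmorphB; ring.
  rewrite cmodM cmodR mulrCA ler_wpM2l //; lra.
- by rewrite rmorph1 mul1r.
Qed.

Let inv_G : G inv. Proof. by apply: (subgroup_generated GM); exact: generated_inversion. Qed.

(* [z => - a^2 / z] is the product of unipotents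
   [[1 a; 0 1] [1 0; -1/a 1] [1 a; 0 1] = [0 a; -1/a 0]]. *)
Lemma arc_component_sqr_inversion (a : C) : a != 0 ->
  arc_component (affine (a ^+ 2) 0 \o inv).
Proof.
move=> a0; have T := arc_component_translation.
have A := arc_component_comp (T a) (arc_component_comp
  (arc_component_conj inv_G inv_G (@inversionK R) (T a^-1)) (T a)).
rewrite (_ : _ \o _ = affine 1 a \o (inv \o (affine 1 a^-1 \o inv) \o affine 1 a)) //.
apply: sph_ext => [|w] /=.
  rewrite /affine !(plane_map_npole, inversion_npole, plane_map_pt) mulr0 !add0r.
  rewrite mulr0 add0r inversion_pt ?invr_eq0 // plane_map_pt invrK; congr pt; ring.
have [->|w0] := eqVneq w 0.
  rewrite /affine inversion_0 !plane_map_npole plane_map_pt mulr0 add0r inversion_pt // plane_map_pt.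
  by rewrite mul1r addNr inversion_0 plane_map_npole.
rewrite inversion_pt // /affine !plane_map_pt mul1r.
have [wa|wa] := eqVneq (w + a) 0.
  rewrite wa inversion_0 plane_map_npole inversion_npole plane_map_pt; congr pt.
  by rewrite (_ : w = - a); [field | apply/eqP; rewrite -addr_eq0 wa].
rewrite (inversion_pt wa) plane_map_pt mul1r (_ : - (w + a)^-1 + a^-1 = w / (a * (w + a))); last first.
  by field; rewrite a0 wa.
rewrite inversion_pt ?mulf_neq0 ?invr_eq0 ?mulf_neq0 // plane_map_pt; congr pt.
by field; rewrite w0 a0 wa.
Qed.

(** The case [a = 1] of [arc_component_sqr_inversion] is the inversion. Composing [z |-> - s^2 / z]
    with it gives the dilation by [s^2], and every nonzero complex number is a square. *)
Lemma generated_arc_component m : generated m -> arc_component m.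
Proof.
have ai : arc_component inv.
  have := arc_component_sqr_inversion (oner_neq0 C); rewrite (_ : affine _ _ \o _ = inv) //.
  apply/funext => p /=; rewrite /affine; case: (sph_cases (inv p)) => [->|[w ->]].
    by rewrite plane_map_npole.
  by rewrite plane_map_pt expr1n mul1r addr0.
elim=> {m} [a b a0||f g _ Af _ Ag]; [|exact: ai|exact: arc_component_comp].
pose s := sqrtc a; have s2 : s ^+ 2 = a by rewrite sqr_sqrtc.
have s0 : s != 0 by rewrite sqrtc_eq0.
have := arc_component_comp (arc_component_translation b)
  (arc_component_comp (arc_component_sqr_inversion s0) ai).
rewrite (_ : _ \o _ = affine a b) //; apply/funext => p /=; rewrite inversionK /affine.
case: (sph_cases p) => [->|[w ->]]; first by rewrite !plane_map_npole.
by rewrite !plane_map_pt s2 addr0 mul1r.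
Qed.

Lemma Mob_arc_component : @Mob R `<=` arc_component.
Proof. by move=> f /Mob_generated /generated_arc_component. Qed.

(* If the normal subgroup [arc_component] were the Moebius group, a
   normalised [f] in [G] would normalise both the translations and the
   dilations, hence be a continuous field automorphism of the plane. *)
Lemma arc_component_nonMob : (exists f, G f /\ ~ Mob f) ->
  exists f, arc_component f /\ ~ Mob f.
Proof.
move=> [f [Gf nMf]]; apply: contrapT => noN.
have AM k : arc_component k -> Mob k.
  by move=> Ak; apply: contrapT => nM; apply: noN; exists k.
have [h [Gh nMh h0 h1]] := normalize_nonMob GD GM Gf nMf.
have SG := subgroup_planar GD GM.
have [h' [Gh' hK h'K]] := planar_inv SG Gh.
have lhK : cancel (plane_map h') (plane_map h).
  move=> p; case: (sph_cases p) => [->|[w ->]]; first by rewrite !plane_map_npole.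
  by rewrite !plane_map_pt h'K.
(* The conjugate of an affine map by [h] stays in the normal subgroup, hence is Moebius by
   assumption; fixing infinity, it is affine. *)
have conj a b : a != 0 -> exists al be, forall v, h (a * v + b) = al * h v + be.
  move=> a0.
  have /AM/MobP[al [be [ga [de [D E]]]]] := arc_component_conj Gh' Gh lhK
    (generated_arc_component (generated_affine b a0)).
  have ga0 : ga = 0.
    have := congr1 (fun k => k (npole R)) E; rewrite /= /affine !plane_map_npole moebius_npole.
    by case: eqVneq => // _ /esym /pt_npole.
  have de0 : de != 0.
    by apply: contraTneq (oner_neq0 C) => d0; rewrite -D ga0 d0 !mulr0 subrr eqxx.
  exists (al / de), (be / de) => v; apply: pt_inj.
  have := congr1 (fun k => k (pt (h v))) E; rewrite /= /affine !plane_map_pt moebius_pt hK => ->.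
  by rewrite ga0 mul0r add0r (negPf de0); congr pt; field.
have hI := planar_inj SG Gh.
have hD x y : h (x + y) = h x + h y.
  have [->|y0] := eqVneq y 0; first by rewrite h0 !addr0.
  have [al [be E]] := conj 1 y (oner_neq0 _).
  have hy : h y = be by have := E 0; rewrite mulr0 add0r h0 mulr0 add0r.
  suff a1 : al = 1 by have := E x; rewrite mul1r a1 mul1r -hy.
  (* A multiplier other than 1 would give the conjugate a finite fixed point, whose preimage under
     [h] would be fixed by translation by [y]. *)
  apply/eqP; apply: contraT => a1; case/eqP: y0.
  have d1 : 1 - al != 0 by rewrite subr_eq0 eq_sym.
  have := E (h' (be / (1 - al))); rewrite h'K mul1r.
  rewrite (_ : al * _ + _ = be / (1 - al)); last by field.
  by rewrite -{2}[be / _]h'K => /hI /eqP; rewrite -subr_eq0 addrAC subrr add0r => /eqP.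
have hM x y : h (x * y) = h x * h y.
  have [->|x0] := eqVneq x 0; first by rewrite h0 !mul0r h0.
  have [al [be E]] := conj x 0 x0.
  have b0 : be = 0 by have := E 0; rewrite mulr0 addr0 h0 mulr0 add0r.
  have hx : h x = al by have := E 1; rewrite mulr1 addr0 h1 mulr1 b0 addr0.
  by have := E y; rewrite addr0 b0 addr0 hx.
have [a [b [sh ba]]] := planar_sdiff SG Gh 0.
have hE := additive_sdiff hD sh.
have ab : a + b = 1 by have := hE 1; rewrite h1 /rlin conjc1 !mulr1.
pose J : C := 'i%C.
have JJ : conjc J = - J by rewrite /J; simpc.
have J2 : J * J = -1 by rewrite -expr2 sqr_i.
have hN : h (-1) = -1.
  by apply/eqP; rewrite -subr_eq0 opprK -{2}h1 -hD addNr h0.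
(* From [h(i)^2 = -1] follows [(a - b)^2 = 1 = (a + b)^2], so [a b = 0]; orientation gives [a != 0]
   and rules out conjugation. *)
have b0 : b = 0.
  have := hM J J; rewrite J2 hN (hE J) /rlin JJ.
  rewrite (_ : _ * _ = (J * J) * (a - b) ^+ 2); last by ring.
  rewrite J2 mulN1r => /oppr_inj ab2.
  have : 4 * a * b = 0.
    transitivity ((a + b) ^+ 2 - (a - b) ^+ 2); first by ring.
    by rewrite ab -ab2 expr1n subrr.
  have a0 : a != 0 by rewrite -cmod_gt0; apply: le_lt_trans ba; exact: cmod_ge0.
  move=> /eqP; rewrite !mulf_eq0 (negPf a0) pnatr_eq0 /= => /eqP //.
apply: nMh; have -> : h = id.
  apply/funext => w; rewrite hE /rlin b0 mul0r addr0.
  by move: ab; rewrite b0 addr0 => ->; rewrite mul1r.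
by rewrite plane_map_id; exact: Mob_id.
Qed.

End IdentityComponent.

Theorem theoremA (R : realType) (G : set (sph R -> sph R)) :
  subgroup_Diff G ->
  Mob (R:=R) `<=` G -> (exists f, G f /\ ~ Mob f) ->
  (forall p q : 'I_4 -> sph R, injective p -> injective q ->
     exists g : R -> sph R -> sph R,
       [/\ forall t, 0 <= t <= 1 -> G (g t),
           g 0 = id,
           unif_cont01 g &
           forall i, g 1 (p i) = q i])
  /\
  (forall p q : 'I_4 -> sph R, injective p -> injective q ->
     exists2 g, G g & forall i, g (p i) = q i).
Proof.
move=> GD GM nM.
have trans := four_transitive (arc_component_subgroup GD) (Mob_arc_component GD GM)
  (arc_component_nonMob GD GM nM).
split=> p q pI qI; have [k Ak kE] := trans p q pI qI.
  by have [g [Gg g0 cg g1]] := Ak; exists g; split=> // i; rewrite g1.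
by exists k => //; exact: arc_component_sub Ak.
Qed.
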